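(* Let $n>1$ be an odd integer and $p$ a prime. Then the following hold. (a) If $n\equiv 1\pmod 4$ is not a sum of two squares, then $\{3,2\}_n=0$. (b) If $p\equiv 13,19\pmod{24}$, then $\{2,2\}_p=0$; if $p\equiv 17,23\pmod{24}$, then $\{2,2\}_p\equiv 0\pmod p$. (c) If $n\equiv 5\pmod 8$, then $\{4,2\}_n=\{8,8\}_n=0$. If $n\equiv 5\pmod{12}$, then $\{3,3\}_n=0$. (d) If $n\equiv 1\pmod 4$ and $\left(\frac{n}{7}\right)=-1$, then $\{42,-7\}_n=\{21,112\}_n=0$. (e) If $n>3$, then $n\mid \{2,3\}_n$. Moreover, for $n>3$, $n^2\mid\{2,3\}_n$ whenever $n\not\equiv\pm1\pmod{12}$; in fact, the divisibility $n^2\mid\{2,3\}_n$ holds for every composite (odd) $n>3$. For every odd $n>7$, one has $n\mid\{6,15\}_n$. (f) If $n\equiv 13,17\pmod{20}$ is a sum of two squares, then $\{5,5\}_n=0$. If $n\equiv 11,19\pmod{20}$, then $\left(\frac{\{5,5\}_n}{n}\right)=0$. (g) If $n\equiv 5\pmod{12}$ is a sum of two squares, then $\{10,9\}_n=0$. If $p\equiv 11\pmod{12}$, then $\{10,9\}_p\equiv 0\pmod p$. (h) If $n\equiv 13,17\pmod{24}$ is a sum of two squares, then $\{8,18\}_n=0$. If $p\equiv 19\pmod{24}$, then $\{8,18\}_p\equiv 0\pmod{p^2}$, while if $p\equiv 23\pmod{24}$, then $\{8,18\}_p\equiv 0\pmod p$.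
   Context: For an odd integer $n>1$, $\left(\frac{\cdot}{n}\right)$ denotes the Jacobi symbol (the Legendre symbol when $n$ is prime). For integers $c,d$, define the integer $$\{c,d\}_n=\det\left[\left(\frac{j^2+cjk+dk^2}{n}\right)\right]_{2\le j,k\le n-2}.$$ ''Sum of two squares'' means a sum of two squares of integers. A notation such as $n\equiv 13,17\pmod{20}$ means $n\equiv 13$ or $n\equiv 17\pmod{20}$. *)

(* Defs.v *)
From mathcomp Require Import all_boot all_order all_algebra.

Set Implicit Arguments.
Unset Strict Implicit.
Unset Printing Implicit Defensive.

Import GRing.Theory.
Local Open Scope ring_scope.

(* Meaningful only when p is an odd prime. *)
Definition legendre (a : int) (p : nat) : int :=
  if (p%:Z %| a)%Z then 0
  else if [exists x : 'I_p, (a == (x : nat)%:Z ^+ 2 %[mod p%:Z])%Z] then 1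
  else -1.

(* Meaningful only when n is odd and positive. *)
Definition jacobi (a : int) (n : nat) : int :=
  \prod_(p <- primes n) legendre a p ^+ logn p n.

Definition sum_of_two_squares (n : nat) : Prop :=
  exists x y : int, n%:Z = x ^+ 2 + y ^+ 2.

(* {c,d}_n: the index range 2 <= j <= n-2 has n-3 elements and is shifted to
   start at 0, so the 'I_(n - 3) index i stands for j = i + 2. For n = 3 the
   matrix is empty and the determinant is 1. *)
Definition jacobi_det (c d : int) (n : nat) : int :=
  \det (\matrix_(i < n - 3, l < n - 3)
    let j : int := (i.+2)%:Z in
    let k : int := (l.+2)%:Z in
    jacobi (j ^+ 2 + c * j * k + d * k ^+ 2) n).

(* Main.v *)
Require Import Defs.
From mathcomp Require Import all_boot all_order all_algebra closed_field.
From mathcomp Require Import ring zify.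

(* If [p] divides [n] exactly once and [n = p m], then a function [u] on [Z/p]
   with [sum_j u(j) ((j^2 + c j k + d k^2) / p) = 0] for all [k], spread over one
   residue class modulo [m], is a left kernel vector of the matrix; for [m = 1] it
   must vanish at [1] and [-1].  Modulo [p] the Legendre symbol is the power
   [q^e] with [e = (p - 1) / 2], so [u(j) = j^i] is such a function modulo [p] as
   soon as [p] divides the coefficient of [x^(p-1-i)] in [(x^2 + c x + d)^e].
   When [u] takes the values [0, 1, -1] (quadratic, quartic or cubic residue
   classes) the sums are smaller than [p], and vanish if [p] divides them.

   For [i = 2, 3] the coefficients are computed directly.  For [i] equal to
   [-1/2], [-1/4] or [-1/3] modulo [p] they are Hasse invariants of elliptic curves
   with complex multiplication, by Q(i), Q(sqrt -2), Q(sqrt -3), Q(sqrt -7),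
   Q(sqrt -5) or Q(sqrt -6), and [p] is inert in that field.  Hasse invariants are
   preserved by isogenies that preserve [dx / y] and are multiplied by [u^(p-1)]
   under [dx / y |-> u dx / y]; hence an endomorphism [u], given by explicit
   isogenies of degree 2 and 3, yields [h = u^(p-1) h], with [u^(p-1) <> 1] because
   [u^p] is the conjugate of [u]. *)

Set Implicit Arguments.
Unset Strict Implicit.
Unset Printing Implicit Defensive.

Import Order.TTheory GRing.Theory Num.Theory.
Local Open Scope ring_scope.

(** * Hasse invariants and isogenies *)

(** The delicate case is a prime [n]: the matrix omits the indices 1 and -1, where a power [j^i]
    does not vanish, so kernel functions must be combined. Two facts supply partners. If [p] does
    not divide [d], the relation [x^2 q(d/x) = d q(x)] for [q = x^2 + c x + d] makes the
    coefficients of [x^i] and [x^(p-1-i)] in [q^e] vanish modulo [p] together; thus [j^i] and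
    [j^(p-1-i)] occur in pairs, and their difference vanishes at 1 and -1. If [d] is not a square
    modulo [p], then [j^(p-1)], the indicator of the nonzero classes, is a kernel function too.
    Divisibility by [p^2] comes from two independent kernel vectors modulo [p], obtained from these
    functions or, for composite [n], from two residue classes modulo [m].

    A congruence on [n] reaches a prime factor because a set of residue classes that contains 1, is
    closed under products and misses [n] also misses some prime factor of [n]. A prime whose square
    divides [n] causes no trouble: two rows of the matrix are then equal. *)

Section Homogenization.

Variables (R : comNzRingType) (N D : {poly R}).

(* [homog e F] is [D^e F(N / D)]. *)
Definition homog (e : nat) (F : {poly R}) : {poly R} :=
  \sum_(k < e.+1) F`_k *: (N ^+ k * D ^+ (e - k)).

Lemma homogD e F G : homog e (F + G) = homog e F + homog e G.
Proof.
by rewrite -big_split; apply: eq_bigr => k _; rewrite coefD scalerDl.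
Qed.

Lemma homogZ e a F : homog e (a *: F) = a *: homog e F.
Proof.
by rewrite /homog scaler_sumr; apply: eq_bigr => k _; rewrite coefZ scalerA.
Qed.

Lemma homogXn e i : (i <= e)%N -> homog e 'X^i = N ^+ i * D ^+ (e - i).
Proof.
move=> ie; rewrite /homog (bigD1 (Ordinal (ie : (i < e.+1)%N))) //=.
rewrite coefXn eqxx scale1r big1 ?addr0 // => j.
by rewrite -val_eqE /= coefXn => /negPf ->; rewrite scale0r.
Qed.

Lemma homog0 e : homog e 0 = 0.
Proof. by rewrite /homog big1 // => k _; rewrite coef0 scale0r. Qed.

Lemma homog_sum e n (F : 'I_n -> {poly R}) :
  homog e (\sum_i F i) = \sum_i homog e (F i).
Proof. exact: (big_morph _ (homogD e) (homog0 e)). Qed.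

Lemma homogM a b (F G : {poly R}) : (size F <= a.+1)%N -> (size G <= b.+1)%N ->
  homog (a + b) (F * G) = homog a F * homog b G.
Proof.
have mono n (P : {poly R}) : (size P <= n.+1)%N ->
    P = \sum_(i < n.+1) P`_i *: 'X^i.
  move=> sP; rewrite -poly_def; apply/polyP => i; rewrite coef_poly.
  by case: ltnP => // ni; rewrite nth_default // (leq_trans sP).
move=> sF sG; rewrite [in LHS](mono _ _ sF) [in LHS](mono _ _ sG).
rewrite mulr_suml homog_sum mulr_suml; apply: eq_bigr => i _.
rewrite mulr_sumr homog_sum mulr_sumr; apply: eq_bigr => j _.
have ia := ltn_ord i; have jb := ltn_ord j; rewrite !ltnS in ia jb.
rewrite -scalerAl -scalerAr !homogZ -exprD !homogXn ?leq_add //.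
rewrite -[RHS]scalerAl -scalerAr; do 2!congr (_ *: _).
have -> : (a + b - (i + j) = (a - i) + (b - j))%N by lia.
by rewrite !exprD; ring.
Qed.

Lemma homogX a m (F : {poly R}) : (size F <= a.+1)%N ->
  homog (a * m) (F ^+ m) = homog a F ^+ m.
Proof.
move=> sF; elim: m => [|m IHm].
  by rewrite muln0 /homog big_ord1 !expr0 coef1 scale1r mulr1.
rewrite mulnS !exprS homogM // ?IHm //.
by apply: leq_trans (size_poly_exp_leq _ _) _;
  rewrite ltnS leq_mul2r -ltnS (leq_trans (leqSpred _)) ?orbT //; lia.
Qed.

End Homogenization.

Section Hasse.

Variables (K : fieldType) (p : nat).
Hypotheses (charKp : p \in [pchar K]) (p_odd : odd p).

Let p_pr : prime p. Proof. exact: pcharf_prime charKp. Qed.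
Let p_gt2 : (2 < p)%N.
Proof. by move: p_pr p_odd; case: (p) => [|[|[|]]]. Qed.

Local Notation m := p./2.

Let p_half : p = (2 * m).+1.
Proof. by have := odd_double_half p; rewrite p_odd; lia. Qed.

(* The Hasse invariant of [y^2 = f(x)], for [f] of degree 3 or 4. *)
Definition hasse (f : {poly K}) : K := (f ^+ m)`_p.-1.

Lemma coef_deriv_pchar (f : {poly K}) i : (p %| i.+1)%N -> (f^`())`_i = 0.
Proof.
by move=> pi; rewrite coef_deriv -mulr_natr (eqP (_ : i.+1%:R == 0)) ?mulr0 //
  -(dvdn_pcharf charKp).
Qed.

(* For [k <> p - 1] the term [N^k D^(2p-2-k) (N'D - ND')] is, up to the
   nonzero factor [k + 1], the derivative of [N^(k+1) D^(2p-1-k)]. *)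
Lemma coef_wronskian n (N D : {poly K}) k :
  let V := N^`() * D - N * D^`() in
  N \is monic -> D \is monic -> V \is monic ->
  size N = n.+2 -> size D = n.+1 -> size V = (2 * n).+1 -> (k <= 2 * p.-1)%N ->
  (N ^+ k * D ^+ (2 * p.-1 - k) * V)`_((2 * n + 1) * p).-1 = (k == p.-1)%:R.
Proof.
move=> V mN mD mV sN sD sV kp; have p_gt0 := prime_gt0 p_pr.
case: eqVneq => [-> | kp1].
  (* For [k = p - 1] the product is monic of degree [(2n+1)p - 1], so the coefficient is the leading
     one. *)
  have -> : (2 * p.-1 - p.-1 = p.-1)%N by lia.
  set P := _ * _ * V.
  have mP : P \is monic by rewrite !monicMl ?monic_exp.
  have sP : size P = ((2 * n + 1) * p).-1.+1.
    rewrite /P !size_Mmonic ?monic_neq0 ?monicMl ?monic_exp //.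
    have sX (Q : {poly K}) l : Q \is monic -> size (Q ^+ l) = ((size Q).-1 * l).+1.
      move=> mQ; have := size_exp Q l; have := monic_neq0 (monic_exp l mQ).
      by rewrite -size_poly_gt0; case: size => // s _ /= ->.
    by rewrite !sX // sN sD sV /=; nia.
  have := monicP mP; rewrite lead_coefE sP /=; by [].
have k1 : k.+1%:R != 0 :> K.
  rewrite -(dvdn_pcharf charKp); apply/negP => /dvdnP [q Eq].
  case: q Eq => [|[|q]] Eq //; [lia | nia].
have dE : (N ^+ k.+1 * D ^+ (2 * p.-1 - k).+1)^`() =
    k.+1%:R *: (N ^+ k * D ^+ (2 * p.-1 - k) * V).
  (* The two exponents add up to [2p], hence are opposite in [K]; this turns the product rule into a
     multiple of [V]. *)
  have Ek : (2 * p.-1 - k).+1%:R = - k.+1%:R :> {poly K}.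
    apply/eqP; rewrite -addr_eq0 -natrD.
    have -> : ((2 * p.-1 - k).+1 + k.+1 = 2 * p)%N by lia.
    by rewrite -(dvdn_pcharf (_ : p \in [pchar {poly K}])) ?pchar_poly // dvdn_mull.
  rewrite derivM !deriv_exp /= -(mulr_natr _ k.+1) -(mulr_natr _ (_ - _).+1) Ek
    -mul_polyC polyC_natr /V !exprS.
  move: (k.+1%:R) (N ^+ k) (D ^+ _) N^`() D^`() => c a b N' D'.
  ring.
have := coef_deriv_pchar (N ^+ k.+1 * D ^+ (2 * p.-1 - k).+1) (i := ((2 * n + 1) * p).-1).
rewrite prednK ?muln_gt0 ?addn1 // dvdn_mull // dE coefZ => /(_ isT) /eqP.
by rewrite mulf_eq0 (negPf k1) => /eqP.
Qed.

(** Since [4m = 2(p-1)], expanding [F^m] produces exactly the products of [coef_wronskian], and only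
    the term [k = p - 1] survives. *)
Lemma hasse_homog n (N D F : {poly K}) :
  let V := N^`() * D - N * D^`() in
  N \is monic -> D \is monic -> V \is monic ->
  size N = n.+2 -> size D = n.+1 -> size V = (2 * n).+1 -> (size F <= 5)%N ->
  (homog N D 4 F ^+ m * V)`_((2 * n + 1) * p).-1 = hasse F.
Proof.
move=> V mN mD mV sN sD sV sF; rewrite -homogX // /homog mulr_suml coef_sum.
have e4 : (4 * m = 2 * p.-1)%N by lia.
have p1 : (p.-1 < (4 * m).+1)%N by lia.
rewrite (bigD1 (Ordinal p1)) //= big1 => [|k]; last first.
  rewrite -val_eqE /= => kp; have lek := ltn_ord k; rewrite ltnS {2}e4 in lek.
  have -> : (4 * m - k = 2 * p.-1 - k)%N by rewrite -e4.
  by rewrite -scalerAl coefZ coef_wronskian // (negPf kp) mulr0.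
have -> : (4 * m - p.-1 = 2 * p.-1 - p.-1)%N by rewrite -e4.
by rewrite addr0 -scalerAl coefZ coef_wronskian ?eqxx ?mulr1 //; lia.
Qed.

Lemma exp_pchar_poly (V : {poly K}) :
  V ^+ p = \sum_(i < size V) (V`_i ^+ p) *: 'X^(i * p).
Proof.
have cP : p \in [pchar {poly K}] by rewrite pchar_poly.
rewrite -(pFrobenius_autE cP) -[V in LHS]coefK poly_def rmorph_sum.
apply: eq_bigr => i _.
by rewrite -mul_polyC rmorphM /= !pFrobenius_autE -polyC_exp -exprM mul_polyC.
Qed.

(* Here [(x, y) |-> (N / D, y V / D^2)] maps [y^2 = f(x)] to [y^2 = F(x)] and
   pulls [dx / y] back to [dx / y]. *)
Lemma hasse_isogeny n (N D F f : {poly K}) :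
  let V := N^`() * D - N * D^`() in
  N \is monic -> D \is monic -> V \is monic ->
  size N = n.+2 -> size D = n.+1 -> size V = (2 * n).+1 ->
  (size F <= 5)%N -> (size f <= 5)%N -> homog N D 4 F = f * V ^+ 2 ->
  hasse f = hasse F.
Proof.
move=> V mN mD mV sN sD sV sF sf E.
rewrite -(hasse_homog mN mD mV sN sD sV sF) E exprMn -exprM -mulrA -exprSr -p_half.
rewrite exp_pchar_poly sV mulr_sumr coef_sum big_ord_recr /=.
have p_gt0 := prime_gt0 p_pr.
have sfm : (size (f ^+ m) <= 2 * p.-1 + 1)%N.
  apply: leq_trans (size_poly_exp_leq _ _) _.
  by have : ((size f).-1 * m <= 4 * m)%N by [rewrite leq_mul2r; lia]; lia.
(* [V^p] has only exponents [i p]. For [i < 2n] the cofactor from [f^m] would need degree at least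
   [2p - 1], just above its bound [2p - 2]. *)
rewrite big1 ?add0r => [|i _]; last first.
  rewrite -scalerAr coefZ coefMXn; case: ltnP => _; first by rewrite mulr0.
  rewrite [X in _ * X]nth_default ?mulr0 //; apply: leq_trans sfm _.
  by have := ltn_ord i; nia.
have -> : V`_(2 * n) = 1 by have := monicP mV; rewrite lead_coefE sV.
rewrite expr1n scale1r coefMXn ifN; last by rewrite -leqNgt; nia.
congr (_`_ _); nia.
Qed.

End Hasse.

(** Cubic models are the case [a = 0], so that cubics and quartics share one transformation law. *)
Definition quartic (R : nzRingType) (a b c d e : R) : {poly R} :=
  a%:P * 'X^4 + b%:P * 'X^3 + c%:P * 'X^2 + d%:P * 'X + e%:P.

Lemma size_quartic (R : nzRingType) (a b c d e : R) :
  (size (quartic a b c d e) <= 5)%N.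
Proof.
have sz k (x : R) : (k <= 4)%N -> (size (x%:P * 'X^k : {poly R})%R <= 5)%N.
  move=> k4; rewrite mul_polyC (leq_trans (size_scale_leq _ _)) //.
  by rewrite size_polyXn.
have szD (P Q : {poly R}) : (size P <= 5 -> size Q <= 5 -> size (P + Q)%R <= 5)%N.
  by move=> sP sQ; rewrite (leq_trans (size_polyD _ _)) // geq_max sP.
rewrite /quartic -[X in d%:P * X]expr1 -[e%:P]mulr1 -(expr0 'X).
by rewrite !szD ?sz.
Qed.

Lemma homog_quartic (R : comNzRingType) (N D : {poly R}) (a b c d e : R) :
  homog N D 4 (quartic a b c d e) =
  a%:P * N ^+ 4 + b%:P * (N ^+ 3 * D) + c%:P * (N ^+ 2 * D ^+ 2) +
  d%:P * (N * D ^+ 3) + e%:P * D ^+ 4.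
Proof.
rewrite /quartic -(expr1 'X) -[X in _ + X]mulr1 -(expr0 'X) !mul_polyC.
by rewrite !homogD !homogZ !homogXn //= mulr1 mul1r.
Qed.

Lemma monic_XnD (R : nzRingType) n (Q : {poly R}) : (size Q <= n)%N ->
  ('X^n + Q \is monic) * (size ('X^n + Q) = n.+1).
Proof.
move=> sQ; split; last by rewrite size_polyDl ?size_polyXn.
by rewrite monicE lead_coefDl ?size_polyXn // lead_coefXn.
Qed.

Lemma size_linear_leq (R : nzRingType) (a b : R) :
  (size (a%:P * 'X + b%:P)%R <= 2)%N.
Proof. by rewrite size_MXaddC; case: ifP => // _; rewrite ltnS size_polyC leq_b1. Qed.

Section HasseTransformations.

Variables (K : fieldType) (p : nat).
Hypotheses (charKp : p \in [pchar K]) (p_odd : odd p).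

Let p_pr : prime p. Proof. exact: pcharf_prime charKp. Qed.
Let p_gt2 : (2 < p)%N.
Proof. by move: p_pr p_odd; case: (p) => [|[|[|]]]. Qed.

Local Notation m := p./2.

Let p_half : p = (2 * m).+1.
Proof. by have := odd_double_half p; rewrite p_odd; lia. Qed.

Local Notation hasse := (hasse p).

Lemma hasse_quartic_isogeny n (N D V f : {poly K}) (a b c d e : K) :
  N^`() * D - N * D^`() = V ->
  N \is monic -> D \is monic -> V \is monic ->
  size N = n.+2 -> size D = n.+1 -> size V = (2 * n).+1 -> (size f <= 5)%N ->
  a%:P * N ^+ 4 + b%:P * (N ^+ 3 * D) + c%:P * (N ^+ 2 * D ^+ 2) +
    d%:P * (N * D ^+ 3) + e%:P * D ^+ 4 = f * V ^+ 2 ->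
  hasse f = hasse (quartic a b c d e).
Proof.
move=> <- mN mD mV sN sD sV sf E.
apply: (hasse_isogeny charKp p_odd mN mD mV sN sD sV (size_quartic _ _ _ _ _) sf).
exact: etrans (homog_quartic _ _ _ _ _ _ _) E.
Qed.

Lemma hasse_quartic_homog n (N D V : {poly K}) (a b c d e : K) :
  N^`() * D - N * D^`() = V ->
  N \is monic -> D \is monic -> V \is monic ->
  size N = n.+2 -> size D = n.+1 -> size V = (2 * n).+1 ->
  hasse (quartic a b c d e) =
  ((a%:P * N ^+ 4 + b%:P * (N ^+ 3 * D) + c%:P * (N ^+ 2 * D ^+ 2) +
    d%:P * (N * D ^+ 3) + e%:P * D ^+ 4) ^+ m * V)`_((2 * n + 1) * p).-1.
Proof.
move=> <- mN mD mV sN sD sV; rewrite -homog_quartic.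
by rewrite -(hasse_homog charKp p_odd mN mD mV sN sD sV (size_quartic _ _ _ _ _)).
Qed.

Lemma hasse_shift (s a b c d e a' b' c' d' e' : K) :
  quartic a' b' c' d' e' =
    a%:P * ('X + s%:P) ^+ 4 + b%:P * ('X + s%:P) ^+ 3 + c%:P * ('X + s%:P) ^+ 2 +
    d%:P * ('X + s%:P) + e%:P ->
  hasse (quartic a' b' c' d' e') = hasse (quartic a b c d e).
Proof.
move=> E; have V1 : ('X + s%:P : {poly K})^`() * 1 - ('X + s%:P) * 1^`() = 1 :> {poly K}.
  by rewrite derivD derivX derivC [1^`()]derivC mulr0 subr0 addr0 mul1r.
apply: (hasse_quartic_isogeny (n := 0) V1);
  rewrite ?monic1 ?size_polyC ?oner_eq0 ?size_quartic ?monicXaddC ?size_XaddC //.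
by rewrite E !expr1n !mulr1.
Qed.

Lemma hasse_scale (c : K) f : hasse (c *: f) = c ^+ m * hasse f.
Proof. by rewrite /hasse exprZn coefZ. Qed.

Lemma hasse_dilate (u : K) f : hasse (f \Po (u *: 'X)) = u ^+ p.-1 * hasse f.
Proof.
rewrite /hasse -rmorphXn /=; set g := f ^+ m.
rewrite comp_polyE coef_sum.
under eq_bigr => i _ do rewrite exprZn scalerA coefZ coefXn.
case: (ltnP p.-1 (size g)) => [lt|ge].
  rewrite (bigD1 (Ordinal lt)) //= eqxx mulr1 big1 ?addr0 1?mulrC // => i.
  by rewrite -val_eqE eq_sym => /negPf ->; rewrite mulr0.
rewrite nth_default // mulr0 big1 // => i _; rewrite gtn_eqF ?mulr0 //.
exact: leq_trans (ltn_ord i) _.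
Qed.

(** This is [x |-> 1/x]: as a form of degree [4m = 2(p-1)], [f^m] has its middle coefficient at
    [p - 1]. *)
Lemma hasse_rev (a b c d e : K) : hasse (quartic a b c d e) = hasse (quartic e d c b a).
Proof.
have E : quartic e d c b a = homog 1 'X 4 (quartic a b c d e).
  by rewrite homog_quartic /quartic !expr1n; ring.
rewrite /hasse E -homogX ?size_quartic // /homog coef_sum.
have p1 : (p.-1 < (4 * m).+1)%N by lia.
rewrite (bigD1 (Ordinal p1)) //= expr1n mul1r coefZ coefXn.
rewrite (_ : (_ == _)) ?mulr1; last by lia.
rewrite big1 ?addr0 // => i; rewrite -val_eqE /= => ip.
by rewrite expr1n mul1r coefZ coefXn (_ : (_ == _) = false) ?mulr0 //; lia.
Qed.

(** The curve carries the marked 2-torsion point [(0, 0)]. Its invariant is the middle coefficient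
    of [(x^2 + A x + B)^m], which links elliptic curves to the Legendre symbol as a kernel
    function. *)
Definition hasse2 (A B : K) := hasse (quartic 0 1 A B 0).

Lemma quartic2E (A B : K) : quartic 0 1 A B 0 = 'X * ('X^2 + A%:P * 'X + B%:P).
Proof. by rewrite /quartic; ring. Qed.

Lemma hasse2E (A B : K) : hasse2 A B = (('X^2 + A%:P * 'X + B%:P) ^+ m)`_m.
Proof.
rewrite /hasse2 /hasse quartic2E exprMn mulrC coefMXn ifN; last by lia.
by congr (_`_ _); lia.
Qed.

Lemma hasse2_scale (u A B : K) : u != 0 -> hasse2 (u * A) (u ^+ 2 * B) = u ^+ m * hasse2 A B.
Proof.
move=> u0; apply: (@mulfI _ (u ^+ (2 * m))); first by rewrite expf_neq0.
rewrite {1}(_ : 2 * m = p.-1)%N; last by lia.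
rewrite -hasse_dilate mulrA -exprD (_ : 2 * m + m = 3 * m)%N; last by lia.
rewrite exprM -hasse_scale; congr hasse.
rewrite -!mul_polyC /quartic.
by rewrite !(rmorphD, rmorphM, rmorphXn) /= !comp_polyX !comp_polyC; ring.
Qed.

Lemma hasse2_even (A B : K) : hasse (quartic 1 0 A 0 B) = hasse2 A B.
Proof.
rewrite hasse2E /hasse.
have -> : quartic 1 0 A 0 B = ('X^2 + A%:P * 'X + B%:P) \Po 'X^2.
  rewrite !(rmorphD, rmorphM, rmorphXn) /= !comp_polyX !comp_polyC /quartic.
  ring.
have e : p.-1 = (2 * m)%N by lia.
by rewrite -rmorphXn /= coef_comp_poly_Xn // e mulKn // dvdn_mulr.
Qed.

(** The hypothesis says that [e] is a root of [x^2 + A x + B]; the shift marks the 2-torsion point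
    [(e, 0)] instead of [(0, 0)]. *)
Lemma hasse2_root_shift (e A B : K) : B = - (e ^+ 2 + A * e) ->
  hasse2 (A + 3%:R * e) (B + 2%:R * A * e + 3%:R * e ^+ 2) = hasse2 A B.
Proof.
move=> E; apply: (@hasse_shift e).
have EP : B%:P = - (e%:P ^+ 2 + A%:P * e%:P) :> {poly K}.
  by rewrite -rmorphXn -rmorphM -!rmorphD -rmorphN; congr _%:P; ring: E.
by rewrite /quartic; ring: EP.
Qed.

(** The isogeny with kernel generated by [(0, 0)], given by [x |-> x + A + B / x]. *)
Lemma hasse2_isogeny2 (A B : K) :
  hasse2 A B = hasse2 (- (2%:R * A)) (A ^+ 2 - 4%:R * B).
Proof.
have VE : ('X^2 + (A%:P * 'X + B%:P) : {poly K})^`() * 'X -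
    ('X^2 + (A%:P * 'X + B%:P)) * ('X)^`() =
    'X^2 + (0%:P * 'X + (- B)%:P).
  by rewrite !derivE; ring.
have mz := monic_XnD (size_linear_leq _ _).
apply: (hasse_quartic_isogeny (n := 1) VE); rewrite ?mz ?monicX ?size_polyX ?size_quartic //.
by rewrite /quartic; ring.
Qed.

(** On the first curve the points with [x = 4] have order three for every [t]. The quotient by them
    is [x |-> x (x - 4t)^2 / (x - 4)^2], which keeps the 2-torsion point [(0, 0)]. *)
Lemma hasse2_isogeny3 (t : K) :
  hasse2 (t ^+ 2 - 6%:R * t - 3%:R) (16%:R * t) =
  hasse2 (t ^+ 2 + 18%:R * t - 27%:R) (16%:R * t ^+ 3).
Proof.
have VE : ('X * ('X - (4%:R * t)%:P) ^+ 2)^`() * ('X - 4%:R%:P) ^+ 2 -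
     ('X * ('X - (4%:R * t)%:P) ^+ 2) * (('X - 4%:R%:P) ^+ 2)^`() =
    ('X - (4%:R * t)%:P) * ('X - 4%:R%:P) *
    ('X^2 + ((4%:R * t - 12%:R)%:P * 'X + (16%:R * t)%:P)) :> {poly K}.
  by rewrite !derivE /=; ring.
have [mQ sQ] := monic_XnD (size_linear_leq (4%:R * t - 12%:R) (16%:R * t)).
apply: (hasse_quartic_isogeny (n := 2) VE);
  rewrite ?size_quartic ?monicMl ?monic_exp ?monicX ?monicXsubC //.
- by rewrite mulrC size_mulX ?size_exp_XsubC ?monic_neq0 ?monic_exp ?monicXsubC.
- by rewrite size_exp_XsubC.
- by rewrite !size_Mmonic ?monic_neq0 ?monicMl ?monicXsubC // sQ !size_XsubC.
by rewrite /quartic; ring.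
Qed.

End HasseTransformations.

(** * Supersingular curves *)

Section Supersingular.

Variables (K : fieldType) (p : nat).
Hypotheses (charKp : p \in [pchar K]) (p_odd : odd p).

Let p_pr : prime p. Proof. exact: pcharf_prime charKp. Qed.
Let p_gt2 : (2 < p)%N.
Proof. by move: p_pr p_odd; case: (p) => [|[|[|]]]. Qed.

Local Notation m := p./2.

Let p_half : p = (2 * m).+1.
Proof. by have := odd_double_half p; rewrite p_odd; lia. Qed.

Let nz2 : 2%:R != 0 :> K.
Proof. by rewrite -(dvdn_pcharf charKp); apply/negP => /dvdn_leq; lia. Qed.

Local Notation hasse := (hasse p).
Local Notation hasse2 := (hasse2 p).
Local Notation q c d := ('X^2 + c%:P * 'X + d%:P : {poly K}).

(* [u^4 + c + d / u^4] is a polynomial in [v = u - t / u]: the curve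
   [y^2 = u^8 + c u^4 + d] covers [y^2 = v^4 + 4 t v^2 + 2 t^2 + c]. *)
Lemma coef_quadratic_power4 (t c d : K) i : t != 0 -> t ^+ 4 = d ->
  (4 * i = 3 * p.-1)%N \/ (4 * i = (3 * p).-1)%N ->
  hasse2 (4%:R * t) (2%:R * t ^+ 2 + c) = 0 -> ((q c d) ^+ m)`_i = 0.
Proof.
move=> t0 td Ei; rewrite -(hasse2_even charKp p_odd).
have VE : ('X^2 + (0%:P * 'X + (- t)%:P))^`() * 'X -
    ('X^2 + (0%:P * 'X + (- t)%:P)) * ('X)^`() =
    'X^2 + (0%:P * 'X + t%:P).
  by rewrite !derivE; ring.
have mz (b : K) := monic_XnD (size_linear_leq 0 b).
rewrite (hasse_quartic_homog charKp p_odd (n := 1) _ _ _ _ _ VE (mz _).1 (monicX K)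
  (mz _).1 (mz _).2 (size_polyX K) (mz _).2).
have -> : 1%:P * ('X^2 + (0%:P * 'X + (- t)%:P)) ^+ 4 +
      0%:P * (('X^2 + (0%:P * 'X + (- t)%:P)) ^+ 3 * 'X) +
      (4%:R * t)%:P * (('X^2 + (0%:P * 'X + (- t)%:P)) ^+ 2 * 'X^2) +
      0%:P * (('X^2 + (0%:P * 'X + (- t)%:P)) * 'X^3) +
      (2%:R * t ^+ 2 + c)%:P * 'X^4 = (q c d) \Po 'X^4.
  rewrite -td !(rmorphD, rmorphM, rmorphXn) /= !comp_polyX !comp_polyC.
  by ring.
rewrite -rmorphXn /= (_ : 'X^2 + (0%:P * 'X + t%:P) = 'X^2 + t%:P); last by ring.
(* The factor [V = X^2 + t] selects the exponents [3p - 3] and [3p - 1] of a polynomial in [X^4];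
   the first is a multiple of 4 when [p = 1], the second when [p = 3] modulo 4. *)
rewrite mulrDr coefD coefMXn coefMC !coef_comp_poly_Xn // ifN; last by lia.
case: Ei => Ei.
  rewrite (_ : ((2 * 1 + 1) * p).-1 - 2 = i * 4)%N; last by lia.
  by rewrite dvdn_mull // mulnK // ifN ?mul0r ?addr0 //; apply/negP => /dvdnP[k]; lia.
rewrite (_ : ((2 * 1 + 1) * p).-1 = i * 4)%N; last by lia.
rewrite dvdn_mull // mulnK // ifN ?add0r; last by apply/negP => /dvdnP[k]; lia.
by move=> /eqP; rewrite mulf_eq0 (negPf t0) orbF => /eqP.
Qed.

(* With [v = u + t^2 / u] the curve [y^2 = u^6 + c u^3 + d] covers
   [y^2 = (v + 2 t) (v^3 - 3 t^2 v + c)]. *)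
Lemma coef_quadratic_power3 (t c d : K) i : t != 0 -> t ^+ 6 = d ->
  (3 * i = 2 * p.-1)%N \/ (3 * i = (2 * p).-1)%N ->
  hasse (quartic 1 (2%:R * t) (- (3%:R * t ^+ 2)) (c - 6%:R * t ^+ 3) (2%:R * t * c)) = 0 ->
  ((q c d) ^+ m)`_i = 0.
Proof.
move=> t0 td Ei.
have VE : ('X^2 + (0%:P * 'X + (t ^+ 2)%:P))^`() * 'X -
    ('X^2 + (0%:P * 'X + (t ^+ 2)%:P)) * ('X)^`() =
    'X^2 + (0%:P * 'X + (- t ^+ 2)%:P).
  by rewrite !derivE; ring.
have mz (b : K) := monic_XnD (size_linear_leq 0 b).
rewrite (hasse_quartic_homog charKp p_odd (n := 1) _ _ _ _ _ VE (mz _).1 (monicX K)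
  (mz _).1 (mz _).2 (size_polyX K) (mz _).2).
have -> : 1%:P * ('X^2 + (0%:P * 'X + (t ^+ 2)%:P)) ^+ 4 +
      (2%:R * t)%:P * (('X^2 + (0%:P * 'X + (t ^+ 2)%:P)) ^+ 3 * 'X) +
      (- (3%:R * t ^+ 2))%:P * (('X^2 + (0%:P * 'X + (t ^+ 2)%:P)) ^+ 2 * 'X^2) +
      (c - 6%:R * t ^+ 3)%:P * (('X^2 + (0%:P * 'X + (t ^+ 2)%:P)) * 'X^3) +
      (2%:R * t * c)%:P * 'X^4 = (('X + t%:P) ^+ 2) * ((q c d) \Po 'X^3).
  rewrite -td !(rmorphD, rmorphM, rmorphXn) /= !comp_polyX !comp_polyC.
  by ring.
rewrite exprMn -exprM -rmorphXn /=.
(* Here [V = (X - t)(X + t)], and its factor [X + t] completes the power [2m] to a [p]-th power,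
   which has only two terms. *)
have -> : ('X + t%:P) ^+ (2 * m) * (((q c d) ^+ m) \Po 'X^3) *
    ('X^2 + (0%:P * 'X + (- t ^+ 2)%:P))
   = ('X + t%:P) ^+ p * (('X - t%:P) * (((q c d) ^+ m) \Po 'X^3)).
  have -> : ('X + t%:P) ^+ p = ('X + t%:P) * ('X + t%:P) ^+ (2 * m) by rewrite -exprS -p_half.
  by move: (_ ^+ (2 * m)) (_ \Po _) => a b; ring.
have -> : ('X + t%:P) ^+ p = 'X^p + (t ^+ p)%:P.
  have cP : p \in [pchar {poly K}] by rewrite pchar_poly.
  by rewrite -(pFrobenius_autE cP) rmorphD /= !pFrobenius_autE rmorphXn.
rewrite mulrDl coefD coefXnM coefCM ifN; last by lia.
rewrite !mulrBl !coefB !coefXM !coefCM !ifN; try by lia.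
rewrite !coef_comp_poly_Xn //.
have nd k : (k %% 3 != 0)%N -> (3 %| k)%N = false by move=> k3; apply: negPf.
case: Ei => Ei.
  rewrite (_ : (((2 * 1 + 1) * p).-1 - p).-1 = i * 3)%N; last by lia.
  rewrite dvdn_mull // mulnK // !nd ?mulr0 ?subr0 ?mulr0 ?addr0 //; lia.
rewrite (_ : (((2 * 1 + 1) * p).-1 - p) = i * 3)%N; last by lia.
rewrite dvdn_mull // mulnK // !nd ?mulr0 ?subr0 ?mulr0 ?addr0 ?sub0r; try by lia.
by move=> /eqP; rewrite oppr_eq0 mulf_eq0 (negPf t0) => /eqP.
Qed.

(** [(X^2 + B)^m] has only even exponents, and [m] is odd. The extra automorphism of the curve
    replaces an isogeny argument here, as it does for [hasse_j0]. *)
Lemma hasse2_j1728 (B : K) : (p %% 4 = 3)%N -> hasse2 0 B = 0.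
Proof.
move=> p3; rewrite hasse2E //.
have -> : q 0 B = ('X + B%:P) \Po 'X^2.
  by rewrite rmorphD /= comp_polyX comp_polyC; ring.
rewrite -rmorphXn /= coef_comp_poly_Xn // ifN //.
by apply/negP => /dvdnP[k]; lia.
Qed.

Lemma hasse_j0 (b : K) : (p %% 3 = 2)%N -> hasse (quartic 0 1 0 0 b) = 0.
Proof.
move=> p2; rewrite /hasse.
have -> : quartic 0 1 0 0 b = ('X + b%:P) \Po 'X^3.
  by rewrite rmorphD /= comp_polyX comp_polyC /quartic; ring.
rewrite -rmorphXn /= coef_comp_poly_Xn // ifN //.
by apply/negP => /dvdnP[k]; lia.
Qed.

Lemma eq_mul_fix0 (c x : K) : x = c * x -> c != 1 -> x = 0.
Proof.
move=> E c1; apply/eqP; move/eqP: E; rewrite -subr_eq0 -{1}[x]mul1r -mulrBl.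
by rewrite mulf_eq0 subr_eq0 eq_sym (negPf c1).
Qed.

Lemma mul_eq0_cancel (c x : K) : c != 0 -> c * x = 0 -> x = 0.
Proof. by move=> c0 /eqP; rewrite mulf_eq0 (negPf c0) => /eqP. Qed.

Lemma hasse2_scale_eq0 (u A B : K) : u != 0 ->
  hasse2 (u * A) (u ^+ 2 * B) = 0 -> hasse2 A B = 0.
Proof.
by move=> u0; rewrite hasse2_scale //; apply: mul_eq0_cancel; rewrite expf_neq0.
Qed.

Lemma hasse_cubic_monic (k b c e : K) : k != 0 ->
  hasse (quartic 0 1 b (c * k) (e * k ^+ 2)) = 0 -> hasse (quartic 0 k b c e) = 0.
Proof.
move=> k0 h; apply: (mul_eq0_cancel (expf_neq0 m (expf_neq0 2 k0))).
rewrite -hasse_scale -[RHS](mulr0 (k ^+ p.-1)) -[X in _ = _ * X]h -hasse_dilate.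
congr hasse; rewrite -!mul_polyC /quartic.
by rewrite !(rmorphD, rmorphM, rmorphXn) /= !comp_polyX !comp_polyC; ring.
Qed.

Lemma opp1_neq1 : -1 != 1 :> K.
Proof. by rewrite eq_sym -addr_eq0. Qed.

Lemma expr_1D_inert_neq1 (z : K) : z != 0 -> z ^+ p = - z ->
  (1 + z) ^+ (2 * m) != 1.
Proof.
move=> z0 zp; apply/eqP => E.
have : (1 + z) ^+ p = 1 - z
  by rewrite -(pFrobenius_autE charKp) rmorphD /= !pFrobenius_autE expr1n zp.
rewrite {1}p_half exprSr E mul1r => /addrI /eqP.
by rewrite -subr_eq0 opprK -mulr2n -mulr_natl mulf_eq0 (negPf nz2) (negPf z0).
Qed.

Lemma expr_inert (D z : K) : z ^+ 2 = D -> D ^+ m = -1 -> z ^+ p = - z.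
Proof. by move=> zD Dm; rewrite {1}p_half exprSr exprM zD Dm mulN1r. Qed.

Lemma hasse2_disc4 : (p %% 4 = 3)%N -> hasse2 (3%:R : K) 2%:R = 0.
Proof.
move=> p3; rewrite -(hasse2_j1728 (-1) p3).
by apply: (hasse_shift charKp p_odd (s := 1)); rewrite /quartic; ring.
Qed.

Lemma hasse2_disc3 : (p %% 3 = 2)%N -> hasse2 (3%:R : K) 3%:R = 0.
Proof.
move=> p3; rewrite -(hasse_j0 (-1) p3).
by apply: (hasse_shift charKp p_odd (s := 1)); rewrite /quartic; ring.
Qed.

(** With [r = 4 / t] one has [x^3 + 4 t x^2 + 16 x = (x + r)^3 - r^3], a shift of a curve with
    [j = 0]. *)
Lemma hasse2_disc12 (t : K) : (p %% 3 = 2)%N -> t ^+ 2 = 3%:R ->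
  hasse2 (4%:R * t) 16%:R = 0.
Proof.
move=> p3 t3; have nz3 : 3%:R != 0 :> K.
  by rewrite -(dvdn_pcharf charKp) dvdn_prime2 //; apply/eqP; lia.
have E : (4%:R / t) ^+ 2 = 16%:R / 3%:R by rewrite -t3; field; apply: contra_neq nz3 => t0;
  rewrite -t3 t0 expr0n.
have t0 : t != 0 by apply: contra_neq nz3 => t0; rewrite -t3 t0 expr0n.
have rE : 3%:R * (4%:R / t) = 4%:R * t by rewrite -t3; field.
have rE2 : 3%:R * (4%:R / t) ^+ 2 = 16%:R by rewrite E; field.
rewrite -(hasse_j0 (- (4%:R / t) ^+ 3) p3).
apply: (hasse_shift charKp p_odd (s := 4%:R / t)).
rewrite /quartic -rE -rE2; move: (4%:R / t) => r; ring.
Qed.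

(* The 2-isogeny is the endomorphism [sqrt (-2)], up to isomorphism. *)
Lemma hasse2_disc8 : (- 2%:R : K) ^+ m = -1 ->
  hasse2 (4%:R : K) 2%:R = 0 /\ hasse2 (8%:R : K) 8%:R = 0.
Proof.
move=> E.
have e1 : hasse2 4%:R 2%:R = hasse2 (- 8%:R : K) 8%:R.
  by rewrite hasse2_isogeny2 //; congr hasse2; ring.
have h : hasse2 (4%:R : K) 2%:R = 0.
  apply: (@eq_mul_fix0 (-1) _ _ opp1_neq1); rewrite -E -hasse2_scale ?oppr_eq0 //.
  by rewrite {1}e1; congr hasse2; ring.
split=> //; apply: (@hasse2_scale_eq0 (-1)); first by rewrite oppr_eq0 oner_eq0.
by rewrite -h e1; congr hasse2; ring.
Qed.

(* The 2-isogeny whose kernel is the root [(- 21 + s) / 2] is the endomorphism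
   [(1 + s) / 2]; it moves this root to its conjugate. *)
Lemma hasse2_disc7 (s : K) : s ^+ 2 = - 7%:R -> (- 7%:R : K) ^+ m = -1 ->
  hasse2 (21%:R : K) 112%:R = 0 /\ hasse2 (42%:R : K) (- 7%:R) = 0.
Proof.
move=> s7 E.
have m0 : (0 < m)%N by lia.
have s0 : s != 0.
  by apply: contra_eq_neq E => s0; rewrite -s7 s0 expr0n /= expr0n gtn_eqF //
    eq_sym oppr_eq0 oner_eq0.
have sp := expr_inert s7 E.
have ne1 := expr_1D_inert_neq1 s0 sp.
have nz1s : 1 + s != 0.
  apply: contra_neq nz2 => s1.
  have : (1 + s) * (1 - s) = 2%:R ^+ 3 by ring: s7.
  by rewrite s1 mul0r => /esym/eqP; rewrite expf_eq0 /= => /eqP.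
(* Scaling the pair [(21, 112)] by 2 moves the other 2-torsion points to [-21 + s] and [-21 - s],
   without denominators. *)
have h : hasse2 42%:R 448%:R = 0 :> K.
  apply: (eq_mul_fix0 _ ne1).
  (* The endomorphism [(1 + s) / 2] contributes [((1 + s)^2 / 4)^m]; since [4^m = 2^(p-1) = 1], the
     denominator drops out. *)
  have E4 : 4%:R ^+ m = 1 :> K.
    have := pFrobenius_aut_nat charKp 2; rewrite pFrobenius_autE {1}p_half exprSr.
    by rewrite exprM -natrX => /(canRL (mulfK nz2)) ->; rewrite mulfV.
  have nz4 : 4%:R != 0 :> K by rewrite (natrM _ 2 2) mulf_neq0.
  have sh (r : K) : r ^+ 2 = - 7%:R ->
    hasse2 (- 21%:R + 3%:R * r) (- 14%:R - 42%:R * r) = hasse2 42%:R 448%:R.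
    move=> r7; rewrite -[RHS](hasse2_root_shift charKp p_odd (e := - 21%:R + r)).
      by congr hasse2; ring: r7.
    by ring: r7.
  rewrite exprM -[LHS]mul1r -[X in X * _ = _]E4.
  have sN7 : (- s) ^+ 2 = - 7%:R by rewrite sqrrN.
  rewrite -[X in 4%:R ^+ m * X](sh s s7) -[X in _ ^+ 2 ^+ m * X](sh _ sN7).
  rewrite [in LHS]hasse2_isogeny2 // -!hasse2_scale ?expf_neq0 //.
  by congr hasse2; ring: s7.
have h1 : hasse2 21%:R 112%:R = 0 :> K.
  by apply: (hasse2_scale_eq0 nz2); rewrite -h; congr hasse2; ring.
split=> //; apply: (@hasse2_scale_eq0 (-1)); first by rewrite oppr_eq0 oner_eq0.
by rewrite -h1 [RHS]hasse2_isogeny2 //; congr hasse2; ring.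
Qed.

(* The 2- and the 3-isogeny both lead to the conjugate curve, where [s] becomes
   [- s]; composing them gives the endomorphism [sqrt (-6)]. *)
Lemma hasse2_disc24 (s : K) : s ^+ 2 = 2%:R -> (- 6%:R : K) ^+ m = -1 ->
  hasse2 12%:R (18%:R + 12%:R * s) = 0.
Proof.
move=> s2 E.
have m0 : (0 < m)%N by lia.
have nz6 : - 6%:R != 0 :> K.
  by apply: contra_eq_neq E => ->; rewrite expr0n gtn_eqF // eq_sym oppr_eq0 oner_eq0.
have nz3 : 3%:R != 0 :> K.
  by apply: contra_neq nz6 => n3; rewrite (natrM _ 2 3) n3 mulr0 oppr0.
have nzw : 8%:R + 6%:R * s != 0.
  apply: contra_neq nz2 => w0.
  have : (8%:R + 6%:R * s) * (6%:R * s - 8%:R) = 2%:R ^+ 3 by ring: s2.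
  by rewrite w0 mul0r => /esym/eqP; rewrite expf_eq0 /= => /eqP.
apply: (@eq_mul_fix0 (-1) _ _ opp1_neq1); rewrite -E.
have -> : - 6%:R = - 2%:R * 3%:R :> K by ring.
rewrite exprMn -mulrA.
apply: etrans (_ : _ = (- 2%:R) ^+ m * hasse2 12%:R (18%:R - 12%:R * s)) _.
  rewrite hasse2_isogeny2 // -hasse2_scale ?oppr_eq0 //.
  by congr hasse2; ring.
congr (_ * _); apply: (mulfI (expf_neq0 m nzw)).
rewrite mulrA -exprMn -!hasse2_scale ?mulf_neq0 //.
(* For this parameter the source is the conjugate curve scaled by [w = 8 + 6s], and the target is
   the original curve scaled by [3w]; thus the 3-isogeny contributes [3^m]. *)
have := hasse2_isogeny3 charKp p_odd (9%:R + 6%:R * s).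
set a := hasse2 _ _; set b := hasse2 _ _ => ab.
apply: etrans (etrans ab _); congr hasse2; ring: s2.
Qed.

(* As for [sqrt (-6)]; now the composite is the endomorphism [1 + sqrt (-5)]. *)
Lemma hasse2_disc20 (s i : K) : s ^+ 2 = 5%:R -> i ^+ 2 = -1 -> 3%:R != 0 :> K ->
  (- 5%:R : K) ^+ m = -1 -> hasse2 4%:R (2%:R + s) = 0.
Proof.
move=> s5 i1 nz3 E.
have m0 : (0 < m)%N by lia.
have z5 : (i * s) ^+ 2 = - 5%:R by ring: s5 i1.
have nz5 : - 5%:R != 0 :> K.
  by apply: contra_eq_neq E => ->; rewrite expr0n gtn_eqF // eq_sym oppr_eq0 oner_eq0.
have z0 : i * s != 0 by apply: contra_neq nz5 => z0; rewrite -z5 z0 expr0n.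
have ne1 := expr_1D_inert_neq1 z0 (expr_inert z5 E).
pose u : K := 2%:R * (- 3%:R + 7%:R * i + s * (3%:R * i - 1)).
pose v : K := 2%:R - i * s.
have nzi : i != 0 by apply: contraNneq (oner_neq0 K) => i0;
  rewrite -[1]opprK -i1 i0 expr0n oppr0.
have nzu : u != 0.
  apply: contra_neq (mulf_neq0 (mulf_neq0 (expf_neq0 4 nz2) nz3) nzi) => u0.
  have : u * (- (2%:R * (- 3%:R + 7%:R * i - s * (3%:R * i - 1)))) = 2%:R ^+ 4 * 3%:R * i.
    by rewrite /u; ring: s5 i1.
  by rewrite u0 mul0r => <-.
have nzv : v != 0.
  apply: contra_neq (expf_neq0 2 nz3) => v0.
  have : v * (2%:R + i * s) = 3%:R ^+ 2 by rewrite /v; ring: s5 i1.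
  by rewrite v0 mul0r => <-.
apply: (eq_mul_fix0 _ ne1).
(* [(1 + i s)^2 = -2 v]: the 2-isogeny accounts for [-2] and the 3-isogeny for [v], its source being
   scaled by [u] and its target by [u v]. *)
have -> : (1 + i * s) ^+ (2 * m) = (- 2%:R) ^+ m * v ^+ m.
  by rewrite exprM -exprMn; congr (_ ^+ m); rewrite /v; ring: s5 i1.
rewrite -mulrA.
apply: etrans (_ : _ = (- 2%:R) ^+ m * hasse2 4%:R (2%:R - s)) _.
  rewrite hasse2_isogeny2 // -hasse2_scale ?oppr_eq0 //.
  by congr hasse2; ring.
congr (_ * _); apply: (mulfI (expf_neq0 m nzu)).
rewrite mulrA -exprMn -!hasse2_scale ?(mulf_neq0 nzu nzv) //.
have := hasse2_isogeny3 charKp p_odd (5%:R + 4%:R * i + 2%:R * s * (1 + i)).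
set a := hasse2 _ _; set b := hasse2 _ _ => ab.
apply: etrans (etrans ab _); congr hasse2; rewrite /u /v; ring: s5 i1.
Qed.

(** After scaling by [t] the curve is [y^2 = (x + 2)(x^3 - 3x + s)] with [s = t^3]. As [s^2 = 2],
    the cubic factor has the root [s]; sending it to infinity gives, up to shift and scaling, the
    curve of [hasse2_disc24] for [- s]. *)
Lemma hasse_signature3 (t : K) : t ^+ 6 = 2%:R -> (- 6%:R : K) ^+ m = -1 ->
  hasse (quartic 1 (2%:R * t) (- (3%:R * t ^+ 2)) (2%:R - 6%:R * t ^+ 3) (2%:R * t * 2%:R)) = 0.
Proof.
move=> t6 E.
have m0 : (0 < m)%N by lia.
pose s := t ^+ 3; have s2 : s ^+ 2 = 2%:R by rewrite -t6 /s; ring.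
have t0 : t != 0 by apply: contra_neq nz2 => t0; rewrite -t6 t0 expr0n.
have s0 : s != 0 by rewrite expf_neq0.
have nz6 : - 6%:R != 0 :> K.
  by apply: contra_eq_neq E => ->; rewrite expr0n gtn_eqF // eq_sym oppr_eq0 oner_eq0.
have nz3 : 3%:R != 0 :> K.
  by apply: contra_neq nz6 => n3; rewrite (natrM _ 2 3) n3 mulr0 oppr0.
have h : hasse2 (6%:R * s) (9%:R - 6%:R * s) = 0.
  apply: (hasse2_scale_eq0 s0).
  by rewrite -(@hasse2_disc24 (- s)) ?sqrrN //; congr hasse2; ring: s2.
pose k := 6%:R + 3%:R * s.
have nzk : k != 0.
  apply: contra_neq (mulf_neq0 (expf_neq0 2 nz3) nz2) => k0.
  have : k * (6%:R - 3%:R * s) = 3%:R ^+ 2 * 2%:R by rewrite /k; ring: s2.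
  by rewrite k0 mul0r => <-.
have h1 : hasse (quartic 0 1 (9%:R + 6%:R * s) ((4%:R * s + 2%:R) * k) (k ^+ 2)) = 0.
  rewrite -[RHS]h; apply: (hasse_shift charKp p_odd (s := 3%:R)).
  have sP : s%:P ^+ 2 = 2%:R :> {poly K} by rewrite -rmorphXn s2 rmorph_nat.
  by rewrite /quartic /k; ring: sP.
have h2 : hasse (quartic 0 k (9%:R + 6%:R * s) (4%:R * s + 2%:R) 1) = 0.
  by apply: (hasse_cubic_monic nzk); rewrite mul1r.
rewrite hasse_rev // in h2.
have h3 : hasse (quartic 1 2%:R (- 3%:R) (s - 6%:R) (2%:R * s)) = 0.
  rewrite -[RHS]h2; apply/esym/(hasse_shift charKp p_odd (s := s)).
  have sP : s%:P ^+ 2 = 2%:R :> {poly K} by rewrite -rmorphXn s2 rmorph_nat.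
  by rewrite /quartic /k; ring: sP.
apply: (mul_eq0_cancel (expf_neq0 p.-1 t0)); rewrite -hasse_dilate.
rewrite -[RHS](mulr0 ((t ^+ 4) ^+ m)) -[X in _ = _ * X]h3 -hasse_scale; congr hasse.
have tP : t%:P ^+ 6 = 2%:R :> {poly K} by rewrite -rmorphXn t6 rmorph_nat.
rewrite -!mul_polyC /quartic /s.
by rewrite !(rmorphD, rmorphM, rmorphXn) /= !comp_polyX !comp_polyC; ring: tP.
Qed.

End Supersingular.

(** * Coefficients of powers of a quadratic polynomial *)

Section QuadraticSymbols.

Variables (K : closedFieldType) (p : nat).
Hypotheses (charKp : p \in [pchar K]) (p_odd : odd p).

Let p_pr : prime p. Proof. exact: pcharf_prime charKp. Qed.
Let p_gt2 : (2 < p)%N.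
Proof. by move: p_pr p_odd; case: (p) => [|[|[|]]]. Qed.

Local Notation m := p./2.

Let p_half : p = (2 * m).+1.
Proof. by have := odd_double_half p; rewrite p_odd; lia. Qed.

Lemma natf_neq0_prime l : prime l -> p != l -> l%:R != 0 :> K.
Proof. by move=> l_pr pl; rewrite -(dvdn_pcharf charKp) dvdn_prime2. Qed.

Lemma exprD_pchar (x y : K) : (x + y) ^+ p = x ^+ p + y ^+ p.
Proof. by rewrite -(pFrobenius_autE charKp) rmorphD /= !pFrobenius_autE. Qed.

Lemma exprN_pchar (x : K) : (- x) ^+ p = - x ^+ p.
Proof. by rewrite exprNn -signr_odd p_odd mulN1r. Qed.

Lemma nth_root_closed (a : K) n : (0 < n)%N -> exists x, x ^+ n = a.
Proof.
move=> n0; have [x E] := solve_monicpoly (fun i => if i is 0%N then a else 0) n0.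
exists x; rewrite E; case: n n0 {E} => // n _.
by rewrite big_ord_recl /= expr0 mulr1 big1 ?addr0 // => i _; rewrite mul0r.
Qed.

Lemma cyclotomic_root l : (0 < l)%N -> exists z : K, z ^+ l = - \sum_(i < l) z ^+ i.
Proof.
move=> l0; have [z E] := solve_monicpoly (fun=> -1 : K) l0; exists z.
by rewrite E -sumrN; apply: eq_bigr => i _; rewrite mulN1r.
Qed.

(** Used with a Gauss sum [g]: Frobenius raises each root of unity in it to the power [p], so the
    sign [e] depends only on a residue class of [p]. *)
Lemma gauss_sum_symbol (D g e : K) : D != 0 -> g ^+ 2 = D -> g ^+ p = e * g -> D ^+ m = e.
Proof.
move=> D0 gD gp; have g0 : g != 0 by apply: contra_neq D0 => g0; rewrite -gD g0 expr0n.
by apply: (mulIf g0); rewrite -gp {2}p_half exprSr exprM gD.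
Qed.

Lemma symbol_N1 : (- 1 : K) ^+ m = if (p %% 4 == 1)%N then 1 else -1.
Proof.
rewrite -signr_odd; case: ifP => h; case o: (odd m) => //=; rewrite ?expr1 ?expr0 //; lia.
Qed.

Lemma symbol_2 : (2%:R : K) ^+ m = if (p %% 8 \in [:: 1; 7])%N then 1 else -1.
Proof.
have [z z4] := nth_root_closed (-1) (isT : (0 < 4)%N).
have z8 : z ^+ 8 = 1 by ring: z4.
apply: (@gauss_sum_symbol _ (z - z ^+ 3)).
- by apply: natf_neq0_prime => //; lia.
- by ring: z4.
rewrite exprD_pchar exprN_pchar -exprM mulnC exprM -(expr_mod p z8).
have : (p %% 8 \in [:: 1; 3; 5; 7])%N by rewrite !inE; lia.
rewrite !inE => /or4P[] /eqP -> /=; ring: z4.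
Qed.

Lemma symbol_N3 : p != 3%N -> (- 3%:R : K) ^+ m = if (p %% 3 == 1)%N then 1 else -1.
Proof.
move=> p3; have [z] := cyclotomic_root (isT : (0 < 2)%N).
rewrite !big_ord_recr big_ord0 /= => E.
have z2 : z ^+ 2 = -1 - z by rewrite E; ring.
have z3 : z ^+ 3 = 1 by rewrite exprS z2; ring: z2.
apply: (@gauss_sum_symbol _ (z - z ^+ 2)).
- by rewrite oppr_eq0 natf_neq0_prime.
- by ring: z3 z2.
rewrite exprD_pchar exprN_pchar -exprM mulnC exprM -(expr_mod p z3).
have : (p %% 3 != 0)%N by rewrite -/(dvdn 3 p) dvdn_prime2 // eq_sym.
have : (p %% 3 < 3)%N by rewrite ltn_mod.
by case: (p %% 3)%N => [|[|[|]]] // _ _ /=; ring: z3 z2.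
Qed.

Lemma symbol_5 : p != 5%N -> (5%:R : K) ^+ m = if (p %% 5 \in [:: 1; 4])%N then 1 else -1.
Proof.
move=> p5; have [z] := cyclotomic_root (isT : (0 < 4)%N).
rewrite !big_ord_recr big_ord0 /= => E.
have z4 : z ^+ 4 = - (1 + z + z ^+ 2 + z ^+ 3) by rewrite E; ring.
have z5 : z ^+ 5 = 1 by rewrite exprS z4; ring: z4.
apply: (@gauss_sum_symbol _ (z - z ^+ 2 - z ^+ 3 + z ^+ 4)).
- by rewrite natf_neq0_prime.
- by ring: z5 z4.
rewrite !exprD_pchar !exprN_pchar -!exprM ![(_ * p)%N]mulnC !exprM -(expr_mod p z5).
have : (p %% 5 != 0)%N by rewrite -/(dvdn 5 p) dvdn_prime2 // eq_sym.
have : (p %% 5 < 5)%N by rewrite ltn_mod.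
by case: (p %% 5)%N => [|[|[|[|[|]]]]] // _ _ /=; ring: z5 z4.
Qed.

Lemma symbol_N7 : p != 7%N -> (- 7%:R : K) ^+ m = if (p %% 7 \in [:: 1; 2; 4])%N then 1 else -1.
Proof.
move=> p7; have [z] := cyclotomic_root (isT : (0 < 6)%N).
rewrite !big_ord_recr big_ord0 /= => E.
have z6 : z ^+ 6 = - (1 + z + z ^+ 2 + z ^+ 3 + z ^+ 4 + z ^+ 5) by rewrite E; ring.
have z7 : z ^+ 7 = 1 by rewrite exprS z6; ring: z6.
apply: (@gauss_sum_symbol _ (z + z ^+ 2 + z ^+ 4 - z ^+ 3 - z ^+ 5 - z ^+ 6)).
- by rewrite oppr_eq0 natf_neq0_prime.
- by ring: z7 z6.
rewrite !exprD_pchar !exprN_pchar -!exprM ![(_ * p)%N]mulnC !exprM -(expr_mod p z7).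
have : (p %% 7 != 0)%N by rewrite -/(dvdn 7 p) dvdn_prime2 // eq_sym.
have : (p %% 7 < 7)%N by rewrite ltn_mod.
by case: (p %% 7)%N => [|[|[|[|[|[|[|]]]]]]] // _ _ /=; ring: z7 z6.
Qed.

Lemma symbol_N6 : (p %% 24 \in [:: 13; 17; 19; 23])%N -> (- 6%:R : K) ^+ m = -1.
Proof.
move=> h; have -> : - 6%:R = 2%:R * - 3%:R :> K by ring.
rewrite exprMn symbol_2 symbol_N3; last by apply: contraTneq h => ->.
move: h; rewrite !inE => h.
have : ((p %% 8 == 1) || (p %% 8 == 7))%N = (p %% 3 != 1)%N by lia.
by case: ifP => _; case: ifP => //= _ _; rewrite ?mul1r ?mulr1.
Qed.

End QuadraticSymbols.

(** * Divisibility of the coefficients by [p] *)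

Section QuadraticPowerCoefficients.

Variable p : nat.
Hypotheses (p_pr : prime p) (p_odd : odd p).

Local Notation m := p./2.

Definition quad_coef (c d : int) (i : nat) : int :=
  (('X^2 + c%:P * 'X + d%:P) ^+ m)`_i.

Let p_gt2 : (2 < p)%N.
Proof. by move: p_pr p_odd; case: (p) => [|[|[|]]]. Qed.

Lemma closed_field_pchar : exists K : closedFieldType, p \in [pchar K].
Proof.
have [K [f _]] := countable_algebraic_closure 'F_p; exists K.
by rewrite (fmorph_pchar f) pchar_Fp.
Qed.

Lemma quad_coef_intr (R : comNzRingType) (c d : int) i :
  (quad_coef c d i)%:~R = (('X^2 + (c%:~R)%:P * 'X + (d%:~R)%:P : {poly R}) ^+ m)`_i.
Proof.
rewrite -[LHS](coef_map intr) rmorphXn /= !rmorphD rmorphM /= rmorphXn /=.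
by rewrite map_polyX !map_polyC.
Qed.

Lemma dvd_quad_coef_half (c d : int) :
  (forall K : closedFieldType, p \in [pchar K] -> hasse2 p (c%:~R : K) d%:~R = 0) ->
  (p %| quad_coef c d m)%Z.
Proof.
have [K cK] := closed_field_pchar => /(_ K cK); rewrite hasse2E // -quad_coef_intr => h.
by rewrite (dvdz_pcharf cK) h.
Qed.

Lemma dvd_quad_coef_3_2 : (p %% 4 = 3)%N -> (p %| quad_coef 3 2 m)%Z.
Proof. by move=> h; apply: dvd_quad_coef_half => K cK; apply: hasse2_disc4. Qed.

Lemma dvd_quad_coef_3_3 : (p %% 3 = 2)%N -> (p %| quad_coef 3 3 m)%Z.
Proof. by move=> h; apply: dvd_quad_coef_half => K cK; apply: hasse2_disc3. Qed.

Lemma symbol_N2 (K : closedFieldType) : p \in [pchar K] ->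
  (p %% 8 \in [:: 5; 7])%N -> (- 2%:R : K) ^+ m = -1.
Proof.
move=> cK h; rewrite -mulN1r exprMn symbol_2 // symbol_N1 //.
move: h; rewrite !inE => h.
have : ((p %% 8 == 1) || (p %% 8 == 7))%N = (p %% 4 != 1)%N by lia.
by case: ifP => _; case: ifP => //= _ _; rewrite ?mul1r ?mulr1.
Qed.

Lemma dvd_quad_coef_4_2 : (p %% 8 \in [:: 5; 7])%N -> (p %| quad_coef 4 2 m)%Z.
Proof.
move=> h; apply: dvd_quad_coef_half => K cK.
by have [] := hasse2_disc8 cK p_odd (symbol_N2 cK h).
Qed.

Lemma dvd_quad_coef_8_8 : (p %% 8 \in [:: 5; 7])%N -> (p %| quad_coef 8 8 m)%Z.
Proof.
move=> h; apply: dvd_quad_coef_half => K cK.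
by have [] := hasse2_disc8 cK p_odd (symbol_N2 cK h).
Qed.

Lemma hasse2_disc7_closed (K : closedFieldType) : p \in [pchar K] ->
  (p %% 7 \in [:: 3; 5; 6])%N ->
  hasse2 p (21%:R : K) 112%:R = 0 /\ hasse2 p (42%:R : K) (- 7%:R) = 0.
Proof.
move=> cK h; have [s s7] := nth_root_closed (- 7%:R : K) (isT : (0 < 2)%N).
apply: (hasse2_disc7 cK p_odd s7).
rewrite symbol_N7 //; last by apply: contraTneq h => ->.
by rewrite ifN //; move: h; rewrite !inE; lia.
Qed.

Lemma dvd_quad_coef_21_112 : (p %% 7 \in [:: 3; 5; 6])%N -> (p %| quad_coef 21 112 m)%Z.
Proof.
move=> h; apply: dvd_quad_coef_half => K cK.
by have [] := hasse2_disc7_closed cK h.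
Qed.

Lemma dvd_quad_coef_42_N7 : (p %% 7 \in [:: 3; 5; 6])%N -> (p %| quad_coef 42 (- 7) m)%Z.
Proof.
move=> h; apply: dvd_quad_coef_half => K cK.
by have [] := hasse2_disc7_closed cK h.
Qed.

Lemma dvd_quad_coef_quarter (c d : int) i :
  (4 * i = 3 * p.-1)%N \/ (4 * i = (3 * p).-1)%N -> ~~ (p %| d)%Z ->
  (forall (K : closedFieldType) (t : K), p \in [pchar K] -> t != 0 -> t ^+ 4 = d%:~R ->
     hasse2 p (4%:R * t) (2%:R * t ^+ 2 + c%:~R) = 0) ->
  (p %| quad_coef c d i)%Z.
Proof.
have [K cK] := closed_field_pchar => Ei pd /(_ K) H.
have [t t4] := nth_root_closed (d%:~R : K) (isT : (0 < 4)%N).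
have t0 : t != 0.
  by apply: contraNneq pd => t0; rewrite (dvdz_pcharf cK) -t4 t0 expr0n.
rewrite (dvdz_pcharf cK) quad_coef_intr.
by rewrite (coef_quadratic_power4 cK p_odd t0 t4 Ei) // H.
Qed.

Lemma dvd_quad_coef_5_5 i :
  (4 * i = 3 * p.-1)%N \/ (4 * i = (3 * p).-1)%N ->
  ((p %% 20 \in [:: 11; 13; 17; 19]))%N -> (p %| quad_coef 5 5 i)%Z.
Proof.
move=> Ei h; apply: dvd_quad_coef_quarter Ei _ _.
  rewrite dvdzE /= dvdn_prime2 //; apply: contraTneq h => -> //.
move=> K t cK t0 t4.
have [j j2] := nth_root_closed (-1 : K) (isT : (0 < 2)%N).
have -> : 4%:R * t = t * 4%:R by rewrite mulrC.
(* As [t^4 = 5], the curve is the one of [hasse2_disc20] for [s = t^2], scaled by [t]. *)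
have -> : 2%:R * t ^+ 2 + 5%:R = t ^+ 2 * (2%:R + t ^+ 2) by ring: t4.
rewrite hasse2_scale // (hasse2_disc20 cK p_odd (i := j)) ?mulr0 //.
- by rewrite -exprM.
- by rewrite (natf_neq0_prime cK) //; apply: contraTneq h => ->.
rewrite -mulN1r exprMn symbol_N1 // symbol_5 //; last by apply: contraTneq h => ->.
move: h; rewrite !inE => h.
have : ((p %% 5 == 1) || (p %% 5 == 4))%N = (p %% 4 != 1)%N by lia.
by case: ifP => _; case: ifP => //= _ _; rewrite ?mul1r ?mulr1.
Qed.

Lemma dvd_quad_coef_10_9 i :
  (4 * i = 3 * p.-1)%N \/ (4 * i = (3 * p).-1)%N -> (p %% 3 = 2)%N ->
  (p %| quad_coef 10 9 i)%Z.
Proof.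
have [K cK] := closed_field_pchar => Ei h.
have p3 : p != 3%N by apply/eqP => p3; rewrite p3 in h.
have nz3 : 3%:R != 0 :> K by rewrite (natf_neq0_prime cK).
(* The fourth root of 9 is taken with [t^2 = 3], so that [2 t^2 + 10 = 16] and the curve has
   [j = 0]. *)
have [t t2] := nth_root_closed (3%:R : K) (isT : (0 < 2)%N).
have t4 : t ^+ 4 = 9%:R by ring: t2.
have t0 : t != 0 by apply: contra_neq nz3 => t0; rewrite -t2 t0 expr0n.
rewrite (dvdz_pcharf cK) quad_coef_intr.
rewrite (coef_quadratic_power4 cK p_odd t0 t4 Ei) // t2 -natrM -natrD.
by rewrite hasse2_disc12.
Qed.

Lemma dvd_quad_coef_8_18 i :
  (4 * i = 3 * p.-1)%N \/ (4 * i = (3 * p).-1)%N ->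
  (p %% 24 \in [:: 13; 17; 19; 23])%N -> (p %| quad_coef 8 18 i)%Z.
Proof.
move=> Ei h; apply: dvd_quad_coef_quarter Ei _ _.
  rewrite dvdzE /= (@Euclid_dvdM 2 (3 ^ 2) p) // (@Euclid_dvdX 3 2 p) // !dvdn_prime2 //.
  by apply: contraTN h => /orP[/eqP -> | /andP[/eqP -> _]].
move=> K t cK t0 t4.
have nz3 : 3%:R != 0 :> K by rewrite (natf_neq0_prime cK) //; apply: contraTneq h => ->.
(* This scaling turns [4t] into 12. With [s = t^2 / 3], [t^4 = 18] gives [s^2 = 2], and the other
   coefficient becomes [18 + 72 / t^2 = 18 + 12 s]. *)
apply: (hasse2_scale_eq0 cK p_odd (u := 3%:R / t)); first by rewrite mulf_neq0 ?invr_neq0.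
rewrite -[RHS](hasse2_disc24 cK p_odd (s := t ^+ 2 / 3%:R)) ?symbol_N6 //; last first.
  by rewrite expr_div_n -exprM t4; field; rewrite (natrM _ 3 3) mulf_neq0.
congr hasse2; first by field; rewrite ?t0.
have -> : 12%:R * (t ^+ 2 / 3%:R) = 4%:R * t ^+ 4 / t ^+ 2 by field; rewrite t0 nz3.
by rewrite t4; field.
Qed.

Lemma dvd_quad_coef_2_2 i :
  (3 * i = 2 * p.-1)%N \/ (3 * i = (2 * p).-1)%N ->
  (p %% 24 \in [:: 13; 17; 19; 23])%N -> (p %| quad_coef 2 2 i)%Z.
Proof.
have [K cK] := closed_field_pchar => Ei h.
have nz2 : 2%:R != 0 :> K by rewrite (natf_neq0_prime cK) //; lia.
have [t t6] := nth_root_closed (2%:R : K) (isT : (0 < 6)%N).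
have t0 : t != 0 by apply: contra_neq nz2 => t0; rewrite -t6 t0 expr0n.
rewrite (dvdz_pcharf cK) quad_coef_intr.
by rewrite (coef_quadratic_power3 cK p_odd t0 t6 Ei) // hasse_signature3 ?symbol_N6.
Qed.

End QuadraticPowerCoefficients.

(** * Weighted sums of Legendre symbols *)

Definition qform (c d j k : int) : int := j ^+ 2 + c * j * k + d * k ^+ 2.

Section PrimeField.

Variable p : nat.
Hypotheses (p_pr : prime p) (p_odd : odd p).

Local Notation m := p./2.
Local Notation F := 'F_p.

Let p_gt2 : (2 < p)%N.
Proof. by move: p_pr p_odd; case: (p) => [|[|[|]]]. Qed.

Let p_half : p = (2 * m).+1.
Proof. by have := odd_double_half p; rewrite p_odd; lia. Qed.

Let charF : p \in [pchar F]. Proof. exact: pchar_Fp. Qed.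

Lemma natFp_eq0 j : (j%:R == 0 :> F) = (p %| j)%N.
Proof. by rewrite (dvdn_pcharf charF). Qed.

Lemma intFp_eq0 (x : int) : (x%:~R == 0 :> F) = (p %| x)%Z.
Proof. by rewrite (dvdz_pcharf charF). Qed.

Lemma intFp_modz (x y : int) : (x = y %[mod p])%Z -> x%:~R = y%:~R :> F.
Proof.
by move=> /eqP; rewrite eqz_mod_dvd -intFp_eq0 rmorphB subr_eq0 => /eqP.
Qed.

Lemma fermat_Fp (x : F) : x != 0 -> x ^+ p.-1 = 1.
Proof.
move=> x0; apply: (mulfI x0); rewrite mulr1 -exprS prednK ?prime_gt0 //.
have := pFrobenius_aut_nat charF x; rewrite pFrobenius_autE natr_Zp; exact.
Qed.

Lemma exists_nonroot (P : {poly F}) : P != 0 -> (size P <= p.-1)%N ->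
  exists j, (0 < j < p)%N /\ P.[j%:R] != 0.
Proof.
move=> P0 sP; have [/allP H|/allPn[j]] := boolP (all (fun j => root P j%:R) (iota 1 p.-1)).
  have := max_poly_roots P0 (rs := [seq j%:R | j <- iota 1 p.-1]).
  rewrite size_map size_iota all_map => /(_ _ _) lt.
  suff : (p.-1 < size P)%N by rewrite ltnNge sP.
  apply: lt; first by apply/allP => j /H.
  rewrite map_inj_in_uniq ?iota_uniq // => i j; rewrite !mem_iota => Hi Hj E.
  wlog ij : i j Hi Hj E / (i <= j)%N.
    by move=> W; case/orP: (leq_total i j) => h; [|symmetry]; apply: W.
  have : (p %| j - i)%N by rewrite -natFp_eq0 natrB // E subrr.
  by move=> /dvdn_leq; case: (posnP (j - i)); lia.
by rewrite mem_iota => Hj jr; exists j; split; [lia | exact: jr].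
Qed.

Lemma exists_expr_neq1 e : (0 < e < p.-1)%N -> exists j, (0 < j < p)%N /\ j%:R ^+ e != 1 :> F.
Proof.
move=> He; have [||j [Hj nj]] := @exists_nonroot ('X^e - 1).
- by rewrite monic_neq0 // monic_Xn_sub_1; lia.
- by rewrite size_Xn_sub_1; lia.
by exists j; split=> //; move: nj; rewrite !hornerE subr_eq0.
Qed.

Lemma sum_Fp (f : F -> F) : \sum_(j < p) f j%:R = \sum_x f x.
Proof.
have castS n : n = p -> \sum_(j < p) f j%:R = \sum_(j < n) f j%:R by move=> ->.
rewrite (castS _ (Fp_cast p_pr)).
by apply: eq_bigr => x _; rewrite natr_Zp.
Qed.

Lemma sum_expr_Fp e :
  \sum_(j < p) j%:R ^+ e = if (0 < e)%N && (p.-1 %| e)%N then -1 else 0 :> F.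
Proof.
rewrite (sum_Fp (fun x => x ^+ e)); case: ifP => [/andP[e0 /dvdnP[k Ek]]|].
  rewrite (bigD1 0) //= expr0n gtn_eqF // add0r.
  rewrite (eq_bigr (fun=> 1)) => [|x x0]; last by rewrite Ek mulnC exprM fermat_Fp ?expr1n.
  rewrite sumr_const cardC1 card_Fp // -[LHS](addrK 1) -mulrSr prednK ?prime_gt0 //.
  by rewrite pcharf0 // sub0r.
case: (posnP e) => [-> _|e0 /= /negbT ne].
  rewrite (eq_bigr (fun=> 1)) => [|x _]; last by rewrite expr0.
  by rewrite sumr_const card_Fp // pcharf0.
have [|j [Hj nj]] := @exists_expr_neq1 (e %% p.-1).
  by rewrite lt0n ne ltn_mod; lia.
have j0 : j%:R != 0 :> F by rewrite natFp_eq0; apply/negP => /dvdn_leq; lia.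
have {}nj : j%:R ^+ e != 1 :> F by rewrite -(expr_mod e (fermat_Fp j0)).
apply/eqP; have : \sum_(x : F) x ^+ e = j%:R ^+ e * \sum_(x : F) x ^+ e.
  rewrite {1}(reindex_inj (mulfI j0)) mulr_sumr.
  by apply: eq_bigr => x _; rewrite exprMn.
move/eqP; rewrite -subr_eq0 -{1}[\sum_x _]mul1r -mulrBl mulf_eq0 subr_eq0.
by rewrite eq_sym (negPf nj).
Qed.

Lemma legendre_euler (x : int) : (legendre x p)%:~R = x%:~R ^+ m :> F.
Proof.
have m0 : (0 < m)%N by lia.
rewrite /legendre -intFp_eq0; case: eqVneq => [-> | x0]; first by rewrite expr0n gtn_eqF.
case: existsP => [[y /eqP /intFp_modz E]|nsq].
  have y0 : (y : nat)%:R != 0 :> F.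
    by apply: contra_neq x0 => y0; rewrite E rmorphXn /= -pmulrn y0 expr0n.
  by rewrite E rmorphXn /= -exprM -pmulrn (_ : 2 * m = p.-1)%N ?fermat_Fp //; lia.
have /eqP : (x%:~R ^+ m) ^+ 2 = 1 :> F.
  by rewrite -exprM (_ : m * 2 = p.-1)%N ?fermat_Fp //; lia.
rewrite sqrf_eq1 => /orP[/eqP xm|/eqP -> //].
(* A nonsquare [x] with [x^m = 1] would give [X^m - 1] the [m + 1] distinct roots
   [x, 1^2, ..., m^2]. *)
pose rs : seq F := x%:~R :: [seq j%:R ^+ 2 | j <- iota 1 m].
have := max_poly_roots (p := 'X^m - 1 : {poly F}) (rs := rs).
rewrite size_Xn_sub_1 //= size_map size_iota ltnn => H; suff : false by [].
have sq_inj i j : (0 < i <= m)%N -> (i <= j <= m)%N -> i%:R ^+ 2 = j%:R ^+ 2 :> F -> i = j.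
  move=> Hi Hj /eqP; rewrite eqf_sqr => /orP[/eqP E | ].
    have : (p %| j - i)%N by rewrite -natFp_eq0 natrB ?E ?subrr //; lia.
    by move=> /dvdn_leq; case: (posnP (j - i)); lia.
  by rewrite -addr_eq0 -natrD natFp_eq0 => /dvdn_leq; lia.
apply: H.
- by rewrite monic_neq0 // monic_Xn_sub_1.
- rewrite /root !hornerE xm subrr eqxx /=; apply/allP => _ /mapP[j Hj ->].
  rewrite mem_iota in Hj; rewrite /root !hornerE -exprM
    (_ : 2 * m = p.-1)%N ?fermat_Fp ?subrr //; last by lia.
  by rewrite natFp_eq0; apply/negP => /dvdn_leq; lia.
apply/andP; split.
  apply/mapP => -[j]; rewrite mem_iota => Hj E; apply: nsq.
  have jp : (j < p)%N by lia.
  exists (Ordinal jp); rewrite eqz_mod_dvd -intFp_eq0 rmorphB rmorphXn /= E -pmulrn.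
  by rewrite subrr.
rewrite map_inj_in_uniq ?iota_uniq // => i j; rewrite !mem_iota => Hi Hj E.
by case: (leqP i j) => h; [|symmetry]; apply: sq_inj => //; lia.
Qed.

Lemma qform_power (c d j k : F) :
  (j ^+ 2 + c * j * k + d * k ^+ 2) ^+ m =
  \sum_(l < p) (('X^2 + c%:P * 'X + d%:P) ^+ m)`_l * (j ^+ l * k ^+ (p.-1 - l)).
Proof.
set q := 'X^2 + _ + _; have sq : (size q <= 3)%N.
  by have [_] := monic_XnD (size_linear_leq c d); rewrite addrA => ->.
have := @homogX _ j%:P k%:P 2 m q sq.
have -> : homog j%:P k%:P 2 q = (j ^+ 2 + c * j * k + d * k ^+ 2)%:P.
  rewrite /q -[in X in X + d%:P](expr1 'X) -[d%:P]mulr1 -(expr0 'X) !mul_polyC.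
  by rewrite !homogD !homogZ !homogXn //= -!mul_polyC; ring.
rewrite -rmorphXn /= => /(congr1 (fun P : {poly F} => P`_0)); rewrite coefC /= => <-.
rewrite coef_sum -p_half.
apply: eq_bigr => l _; rewrite -!rmorphXn -rmorphM coefZ coefC /=.
by congr (_ * (_ * _ ^+ (_ - _))); lia.
Qed.

(** By Euler's criterion and the power sums over the field, only those [l] count for which [l + i]
    is a positive multiple of [p - 1]: this is [l = p - 1 - i], and for [i = p - 1] also
    [l = p - 1]. *)
Lemma sum_legendre_power (c d k : int) i : (0 < i <= p.-1)%N ->
  \sum_(j < p) j%:R ^+ i * (legendre (qform c d j k) p)%:~R =
  - (quad_coef p c d (p.-1 - i))%:~R * k%:~R ^+ i
  - (if i == p.-1 then (quad_coef p c d i)%:~R else 0) :> F.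
Proof.
move=> Hi; pose a l : F := (quad_coef p c d l)%:~R.
transitivity (\sum_(l < p) a l * k%:~R ^+ (p.-1 - l) * \sum_(j < p) j%:R ^+ (l + i) : F).
  under [RHS]eq_bigr => l _ do rewrite mulr_sumr.
  rewrite exchange_big /=; apply: eq_bigr => j _.
  rewrite legendre_euler /qform !(rmorphD, rmorphXn, rmorphM) /= -pmulrn qform_power mulr_sumr.
  apply: eq_bigr => l _; rewrite -quad_coef_intr -/(a l) exprD; ring.
under eq_bigr => l _ do rewrite sum_expr_Fp.
have p1 : (p.-1 - i < p)%N by lia.
rewrite (bigD1 (Ordinal p1)) //= subnK ?dvdnn; last by lia.
rewrite (_ : (p.-1 - (p.-1 - i) = i)%N); last by lia.
rewrite (_ : (0 < p.-1)%N) /=; last by lia.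
rewrite mulrN1 -mulNr -/(a _); congr (_ + _).
have lP (l : 'I_p) : l != Ordinal p1 -> (0 < l + i)%N && (p.-1 %| l + i)%N ->
  l = p.-1 :> nat /\ i = p.-1.
  have ltl := ltn_ord l; rewrite -val_eqE /= => nl /andP[_ /dvdnP[e Ee]].
  case: e Ee => [|[|[|e]]] Ee; nia.
case: eqVneq => [ip|ip]; last first.
  by rewrite oppr0 big1 // => l nl; case: ifP => [/(lP _ nl)[_ /eqP]|]; rewrite ?mulr0 //
    (negPf ip).
have pp : (p.-1 < p)%N by lia.
rewrite (bigD1 (Ordinal pp)) /=; last by rewrite -val_eqE /=; lia.
rewrite big1 => [|l /andP[nl nl2]]; last first.
  by case: ifP => [/(lP _ nl)[lp _]|]; rewrite ?mulr0 //; move: nl2;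
    rewrite -val_eqE /= lp eqxx.
rewrite subnn expr0 mulr1 addr0 -ip dvdn_add // (_ : (0 < _)%N) ?mulrN1 //; lia.
Qed.

Lemma quad_coef0 (c d : int) : quad_coef p c d 0 = d ^+ m.
Proof. by rewrite /quad_coef -horner_coef0 !hornerE. Qed.

Lemma quad_coef_lead (c d : int) : quad_coef p c d p.-1 = 1.
Proof.
have [mq sq] := monic_XnD (size_linear_leq c d); rewrite addrA in mq sq.
have := monicP (monic_exp m mq); rewrite lead_coefE.
have := size_exp ('X^2 + c%:P * 'X + d%:P) m; rewrite sq => ->.
by rewrite /quad_coef; congr (_ `_ _ = 1); lia.
Qed.

(** From [x^2 q(d/x) = d q(x)], the coefficients [a_i] of [q^m] satisfy
    [d^m a_i = d^(p-1-i) a_(p-1-i)]. *)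
Lemma dvd_quad_coef_sym (c d : int) i : (i <= p.-1)%N -> ~~ (p %| d)%Z ->
  (p %| quad_coef p c d i)%Z -> (p %| quad_coef p c d (p.-1 - i))%Z.
Proof.
move=> ip pd pa; set q : {poly int} := 'X^2 + c%:P * 'X + d%:P.
have sq : (size q <= 3)%N.
  by have [_] := monic_XnD (size_linear_leq c d); rewrite addrA => ->.
have := @homogX _ d%:P 'X 2 m q sq.
have -> : homog d%:P 'X 2 q = d%:P * q.
  rewrite /q -[in X in X + d%:P](expr1 'X) -[X in _ + X]mulr1 -(expr0 'X) !mul_polyC.
  by rewrite !homogD !homogZ !homogXn //= -!mul_polyC; ring.
rewrite exprMn -rmorphXn => /(congr1 (fun P : {poly int} => P`_i)).
have p1 : (p.-1 - i < (2 * m).+1)%N by lia.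
rewrite /homog coef_sum (bigD1 (Ordinal p1)) //= big1 => [|l nl]; last first.
  rewrite -rmorphXn coefZ coefCM coefXn (_ : (_ == _) = false) ?mulr0 //.
  by move: nl (ltn_ord l); rewrite -val_eqE /=; lia.
rewrite -rmorphXn coefZ !coefCM coefXn (_ : (_ == _)) ?mulr1 ?addr0; last by lia.
move=> E; move: pa; rewrite -!intFp_eq0 => /eqP pa.
have : (quad_coef p c d (p.-1 - i))%:~R * (d%:~R ^+ (p.-1 - i)) = 0 :> F.
  by rewrite -rmorphXn -rmorphM /= E rmorphM /= -/(quad_coef p c d i) pa mulr0.
by move=> /eqP; rewrite mulf_eq0 expf_eq0 !intFp_eq0 (negPf pd) andbF orbF.
Qed.

(* At most [p - 1] of the terms are nonzero and each is a sign, so divisibility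
   by [p] forces the sum to vanish: no Hasse-Weil bound is needed. *)
Lemma sum_signs_eq0 (u : nat -> int) (c d k : int) :
  u 0%N = 0 -> (forall s, `|u s| <= 1) ->
  \sum_(s < p) (u s)%:~R * (legendre (qform c d s k) p)%:~R = 0 :> F ->
  \sum_(s < p) u s * legendre (qform c d s k) p = 0.
Proof.
move=> u0 u1; under eq_bigr => s _ do rewrite -rmorphM.
rewrite -rmorph_sum /= => /eqP; rewrite intFp_eq0.
set S := \sum_(s < p) u s * _ => pS.
have leS : `|S| <= p.-1%:Z.
  apply: le_trans (ler_norm_sum _ _ _) _.
  have l1 x : `|legendre x p| <= 1 by rewrite /legendre; case: ifP => // _; case: ifP.
  have p0 : (0 < p)%N by lia.
  rewrite (bigD1 (Ordinal p0)) //= u0 mul0r normr0 add0r.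
  apply: le_trans (ler_sum _ (_ : forall s : 'I_p, s != Ordinal p0 -> _ <= 1)) _.
    by move=> s _; rewrite normrM mulr_ile1.
  by rewrite sumr_const cardC1 card_ord -[X in _ <= X]natz.
apply/eqP; apply: contraLR pS => S0; rewrite dvdzE /=; apply/negP => /dvdn_leq.
by lia.
Qed.

End PrimeField.

(** * Determinants of Jacobi symbols *)

Lemma legendre_modz (x y : int) (q : nat) : (x = y %[mod q])%Z -> legendre x q = legendre y q.
Proof.
move=> E; have E1 : (q %| x)%Z = (q %| y)%Z by apply/dvdz_mod0P/dvdz_mod0P; rewrite E.
have E2 : [exists z : 'I_q, (x == (z : nat)%:Z ^+ 2 %[mod q])%Z] =
    [exists z : 'I_q, (y == (z : nat)%:Z ^+ 2 %[mod q])%Z].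
  by apply: eq_existsb => z; rewrite E.
by rewrite /legendre E1 E2.
Qed.

Lemma jacobi_modz (x y : int) n :
  (forall q, q \in primes n -> (x = y %[mod q])%Z) -> jacobi x n = jacobi y n.
Proof. by move=> E; apply: eq_big_seq => q /E/legendre_modz ->. Qed.

Lemma jacobi_primeM (x : int) p m : prime p -> coprime p m -> (0 < m)%N ->
  jacobi x (p * m) = legendre x p * jacobi x m.
Proof.
move=> p_pr cop m0; have p0 := prime_gt0 p_pr.
have pm : p \notin primes m by rewrite mem_primes p_pr m0 -prime_coprime ?cop.
rewrite /jacobi (perm_big (p :: primes m)) /=; last first.
  rewrite uniq_perm ?primes_uniq //= ?pm ?primes_uniq // => q.
  by rewrite primesM // in_cons primes_prime // inE.
rewrite big_cons lognM // logn_prime // eqxx (logn_coprime cop) addn0 expr1.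
congr (_ * _); apply: eq_big_seq => q qm; rewrite lognM // logn_prime //.
by case: eqVneq qm pm => [-> -> | ].
Qed.

Lemma qform_modz (c d j j' k : int) (q : nat) : (j = j' %[mod q])%Z ->
  (qform c d j k = qform c d j' k %[mod q])%Z.
Proof.
move=> /eqP; rewrite eqz_mod_dvd => E; apply/eqP; rewrite eqz_mod_dvd.
have -> : qform c d j k - qform c d j' k = (j + j' + c * k) * (j - j').
  by rewrite /qform; ring.
exact: dvdz_mull.
Qed.

Lemma sum_crt (R : nmodType) p m (G : nat -> nat -> R) : coprime p m ->
  (0 < p)%N -> (0 < m)%N ->
  \sum_(j < p * m) G (j %% p)%N (j %% m)%N = \sum_(s < p) \sum_(r < m) G s r.
Proof.
move=> cop p0 m0; rewrite pair_big /=.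
pose h (j : 'I_(p * m)) : 'I_p * 'I_m :=
  (Ordinal (ltn_pmod j p0), Ordinal (ltn_pmod j m0)).
have h_inj : injective h.
  move=> i j [Ep Em]; apply/val_inj => /=.
  have : (i == j %[mod p * m])%N by rewrite chinese_remainder // Ep Em !eqxx.
  by rewrite !modn_small // => /eqP.
have h_bij : bijective h by apply: inj_card_bij => //; rewrite card_prod !card_ord.
by rewrite (reindex h) //; apply: onW_bij.
Qed.

Definition crt_vec (R : nmodType) (p m a : nat) (u : nat -> R) (j : nat) : R :=
  if (j %% m == a)%N then u (j %% p)%N else 0.

Lemma crt_vec_sum (R : comNzRingType) p m a (u : nat -> R) (c d k : int) :
  prime p -> coprime p m -> (a < m)%N ->
  \sum_(j < p * m) crt_vec p m a u j * (jacobi (qform c d j k) (p * m))%:~R =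
  (jacobi (qform c d a k) m)%:~R *
  \sum_(s < p) u s * (legendre (qform c d s k) p)%:~R.
Proof.
move=> p_pr cop am; have m0 : (0 < m)%N by apply: leq_trans am.
pose G s r : R := if (r == a)%N then
  (jacobi (qform c d a k) m)%:~R * (u s * (legendre (qform c d s k) p)%:~R) else 0.
transitivity (\sum_(j < p * m) G (j %% p)%N (j %% m)%N).
  apply: eq_bigr => j _; rewrite /crt_vec /G; case: eqVneq => [ja|]; last by rewrite mul0r.
  have -> : jacobi (qform c d j k) (p * m) =
      legendre (qform c d (j %% p)%N k) p * jacobi (qform c d a k) m.
    rewrite jacobi_primeM //; congr (_ * _).
      by apply: legendre_modz; apply: qform_modz; rewrite !modz_nat modn_mod.
    apply: jacobi_modz => q; rewrite mem_primes => /and3P[_ _ qm].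
    by apply: qform_modz; rewrite !modz_nat -ja modn_dvdm.
  by rewrite rmorphM mulrA mulrC.
rewrite (sum_crt G cop (prime_gt0 p_pr) m0) mulr_sumr; apply: eq_bigr => s _.
rewrite (bigD1 (Ordinal am)) //= /G eqxx big1 ?addr0 // => r.
by rewrite -val_eqE /= => /negPf ->.
Qed.

Definition jacobi_mx (c d : int) (n : nat) : 'M[int]_(n - 3) :=
  \matrix_(i, l) jacobi (qform c d i.+2 l.+2) n.

Lemma jacobi_detE c d n : jacobi_det c d n = \det (jacobi_mx c d n).
Proof. by []. Qed.

(** The sums run over all residues, where they can be evaluated; the three zeros let [v] restrict to
    the row indices [2, ..., n - 2]. *)
Definition kernel_vec (R : nzRingType) n (c d : int) (v : nat -> R) : Prop :=
  [/\ v 0%N = 0, v 1%N = 0, v n.-1 = 0 &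
   forall k, (1 < k < n.-1)%N ->
     \sum_(j < n) v j * (jacobi (qform c d j k%:Z) n)%:~R = 0].

Definition row_of (R : nzRingType) n (v : nat -> R) : 'rV[R]_(n - 3) := \row_i v i.+2.

Lemma mulmx_row_of (R : nzRingType) n (c d : int) (v : nat -> R) : kernel_vec n c d v ->
  row_of n v *m map_mx intr (jacobi_mx c d n) = 0.
Proof.
move=> [v0 v1 vn H]; apply/rowP => l; rewrite !mxE.
have ln := ltn_ord l; have n3 : (3 < n)%N by lia.
have lk : (1 < l.+2 < n.-1)%N by lia.
rewrite -[RHS](H _ lk) -(big_mkord xpredT (fun j => v j * (jacobi (qform c d j l.+2) n)%:~R)).
rewrite (big_cat_nat (n := 2)) //=; last by lia.
rewrite (big_cat_nat (m := 2) (n := n.-1)) //=; try by lia.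
rewrite big_nat_recl // big_nat1 v0 v1 !mul0r !add0r.
rewrite [X in _ + X]big_nat [X in _ + X]big1 ?addr0 => [|i Hi]; last first.
  by rewrite (_ : i = n.-1) ?vn ?mul0r //; lia.
rewrite -[X in index_iota X _]add0n big_addn (_ : n.-1 - 2 = n - 3)%N; last by lia.
by rewrite big_mkord; apply: eq_bigr => i _; rewrite !mxE addn2.
Qed.

Lemma kernel_vec_range (R : nzRingType) n c d (v : nat -> R) j :
  kernel_vec n c d v -> (j < n)%N -> v j != 0 -> (1 < j < n.-1)%N.
Proof.
move=> [v0 v1 vn _] jn vj.
have : j != 0%N by apply: contra_neq vj => ->.
have : j != 1%N by apply: contra_neq vj => ->.
have : j != n.-1 by apply: contra_neq vj => ->.
lia.
Qed.

Lemma det_kernel_vec (R : idomainType) n c d (v : nat -> R) :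
  kernel_vec n c d v -> (exists2 j, (j < n)%N & v j != 0) ->
  (jacobi_det c d n)%:~R = 0 :> R.
Proof.
move=> kv [j jn vj]; have Hj := kernel_vec_range kv jn vj.
rewrite jacobi_detE -(det_map_mx intr); apply/eqP/det0P.
exists (row_of n v); last exact: mulmx_row_of.
have j2 : (j - 2 < n - 3)%N by lia.
apply: contra_neq vj => /rowP /(_ (Ordinal j2)); rewrite !mxE /= => <-.
by congr v; lia.
Qed.

(** Deleting entry [j1] from [w] leaves a nonzero kernel vector of every minor without row [j1], so
    column [j1] of the adjugate is divisible by [p]. For an integer lift [V] of [v], [V M] is also
    divisible by [p], and [V M adj(M) = det(M) V]; at [j1] the factor of [det(M)] is a unit modulo
    [p]. *)
Lemma dvd_sq_det_row_kernel p N (M : 'M[int]_N) (v w : 'rV['F_p]_N) (j1 j2 : 'I_N) :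
  prime p -> v *m map_mx intr M = 0 -> w *m map_mx intr M = 0 ->
  v 0 j1 != 0 -> w 0 j1 = 0 -> w 0 j2 != 0 -> (p%:Z ^+ 2 %| \det M)%Z.
Proof.
case: N M v w j1 j2 => [|N] M v w j1 j2; first by case: j1.
move=> p_pr vM wM vj wj1 wj2.
have charF := pchar_Fp p_pr.
have dvdF (x : int) : (p %| x)%Z = (x%:~R == 0 :> 'F_p) by rewrite (dvdz_pcharf charF).
have adj0 k : (p %| \adj M k j1)%Z.
  rewrite dvdF mxE /cofactor rmorphM /= mulf_eq0 -(det_map_mx intr); apply/orP; right.
  apply/det0P; exists (col' j1 w).
    apply: contra_neq wj2 => /rowP H.
    case: (unliftP j1 j2) => [i ->|->] //; have := H i; rewrite !mxE; exact.
  apply/rowP => l; rewrite !mxE; have /rowP /(_ (lift k l)) := wM; rewrite !mxE.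
  rewrite (bigD1_ord j1) //= wj1 mul0r add0r => H; rewrite -[RHS]H.
  by apply: eq_bigr => i _; rewrite !mxE.
pose V : 'rV[int]_N.+1 := \row_j (v 0 j : nat)%:Z.
have VF : map_mx intr V = v by apply/rowP => j; rewrite !mxE -pmulrn natr_Zp.
have E : \det M * V 0 j1 = \sum_k (V *m M) 0 k * \adj M k j1.
  transitivity ((V *m M *m \adj M) 0 j1); last by rewrite [LHS]mxE.
  by rewrite -mulmxA mul_mx_adj mul_mx_scalar [RHS]mxE.
have pV : ~~ (p %| V 0%R j1)%Z by rewrite dvdF; move: vj; rewrite -{1}VF mxE.
have : (p%:Z ^+ 2 %| (\det M * V 0 j1)%R)%Z.
  rewrite E; apply: (big_ind (fun x => p%:Z ^+ 2 %| x)%Z) => [||k _]; rewrite ?dvdz0 //.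
    by move=> x y; apply: rpredD.
  rewrite expr2; apply: dvdz_mul => //; rewrite dvdF.
  have /rowP /(_ k) := vM; rewrite -VF -map_mxM !mxE => ->.
  by rewrite eqxx.
rewrite Gauss_dvdzl // coprimezXl // coprimezE prime_coprime //.
Qed.

Lemma dvd_sq_det_kernel_vec p n c d (v w : nat -> 'F_p) j1 j2 : prime p ->
  kernel_vec n c d v -> kernel_vec n c d w -> (j1 < n)%N -> (j2 < n)%N ->
  v j1 != 0 -> w j1 = 0 -> w j2 != 0 -> (p%:Z ^+ 2 %| jacobi_det c d n)%Z.
Proof.
move=> p_pr kv kw j1n j2n vj wj1 wj2.
have Hj1 := kernel_vec_range kv j1n vj; have Hj2 := kernel_vec_range kw j2n wj2.
have l1 : (j1 - 2 < n - 3)%N by lia.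
have l2 : (j2 - 2 < n - 3)%N by lia.
have e1 : (j1 - 2).+2 = j1 by lia.
have e2 : (j2 - 2).+2 = j2 by lia.
rewrite jacobi_detE.
by apply: (dvd_sq_det_row_kernel (j1 := Ordinal l1) (j2 := Ordinal l2) p_pr
  (mulmx_row_of kv) (mulmx_row_of kw)); rewrite !mxE /= ?e1 ?e2.
Qed.

Lemma crt_kernel_vec (R : comNzRingType) p m a (u : nat -> R) (c d : int) :
  prime p -> coprime p m -> (a < m)%N -> u 0%N = 0 ->
  (m = 1%N /\ u 1%N = 0 /\ u p.-1 = 0) \/ ((1 < m) && (a != 1) && (a != m.-1))%N ->
  (forall k, (1 < k < (p * m).-1)%N ->
     \sum_(s < p) u s * (legendre (qform c d s k%:Z) p)%:~R = 0) ->
  kernel_vec (p * m) c d (crt_vec p m a u).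
Proof.
move=> p_pr cop am u0 Hm H; have p1 := prime_gt1 p_pr.
split=> [|||k /H E]; last by rewrite crt_vec_sum // E mulr0.
- by rewrite /crt_vec !mod0n u0; case: ifP.
- rewrite /crt_vec; case: Hm => [[-> [u1 _]]|/andP[/andP[m1 a1] _]].
    by rewrite modn1 (modn_small p1) u1; case: ifP.
  by rewrite modn_small // eq_sym (negPf a1).
rewrite /crt_vec; case: Hm => [[m1 [_ up]]|/andP[/andP[m1 _] am1]].
  by rewrite m1 muln1 (modn_small (_ : p.-1 < p)%N) ?up; [case: ifP | lia].
(* The last index lies in the class of -1 modulo [m], which differs from [a]. *)
have -> : (p * m).-1 = (p.-1 * m + m.-1)%N by nia.
by rewrite modnMDl modn_small ?(eq_sym _ a) ?(negPf am1) //; lia.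
Qed.

Lemma crt_vec_neq0 (R : nmodType) p m a (u : nat -> R) s :
  (0 < p)%N -> coprime p m -> (a < m)%N -> (s < p)%N -> u s != 0 ->
  exists j, [/\ (j < p * m)%N, (j %% m = a)%N & crt_vec p m a u j != 0].
Proof.
move=> p0 cop am sp us; pose j := (chinese p m s a %% (p * m))%N.
have jm : (j %% m = a)%N.
  by rewrite /j modn_dvdm ?dvdn_mull // chinese_modr // modn_small.
have jp : (j %% p = s)%N.
  by rewrite /j modn_dvdm ?dvdn_mulr // chinese_modl // modn_small.
exists j; split=> //; first by rewrite ltn_mod muln_gt0 p0 (leq_trans _ am).
by rewrite /crt_vec jm eqxx jp.
Qed.

(** Every prime factor of [n] divides [n / p], so the rows of index [2] and [2 + n / p] are
    equal. *)
Lemma jacobi_det_square_factor c d n p : prime p -> odd n -> (p ^ 2 %| n)%N ->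
  jacobi_det c d n = 0.
Proof.
move=> p_pr n_odd /dvdnP[e En]; have p1 := prime_gt1 p_pr.
have podd : odd p by move: n_odd; rewrite En oddM oddX => /andP[].
have e0 : (0 < e)%N by case: e En n_odd => // ->.
have p3 : (2 < p)%N by move: p1 podd; case: (p) => [|[|[|]]].
have r0 : (e * p + 4 <= n)%N by rewrite En; nia.
have i1 : (0 < n - 3)%N by lia.
have i2 : (e * p < n - 3)%N by lia.
rewrite jacobi_detE; apply: (determinant_alternate (i1 := Ordinal i1) (i2 := Ordinal i2)).
  by rewrite -val_eqE /= eq_sym -lt0n muln_gt0 e0; lia.
move=> l; rewrite !mxE; apply: jacobi_modz => q; rewrite mem_primes => /and3P[q_pr _ qn].
apply: qform_modz; apply/eqP; rewrite eqz_mod_dvd.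
have -> : (Ordinal i1).+2%:Z - (Ordinal i2).+2%:Z = - (e * p)%:Z by rewrite /= ; lia.
rewrite dvdzE abszN /=.
by move: qn; rewrite En -mulnn !Euclid_dvdM // orbb.
Qed.

Lemma prime_divisor_split c d n p : prime p -> odd n -> (p %| n)%N ->
  jacobi_det c d n = 0 \/
  exists m, [/\ n = (p * m)%N, coprime p m & m = 1%N \/ (2 < m)%N].
Proof.
move=> p_pr n_odd /dvdnP[m En]; have [pm|pm] := boolP (p %| m)%N.
  left; apply: (@jacobi_det_square_factor _ _ _ p) => //.
  by rewrite En mulnC -mulnn dvdn_mul.
right; exists m; split; rewrite ?prime_coprime //; first by rewrite En mulnC.
by move: n_odd; rewrite En oddM => /andP[]; case: (m) => [|[|[|]]] //; [left | right].
Qed.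

Lemma ndvdz_lt (p k : nat) : (0 < k < p)%N -> ~~ (p %| k%:Z)%Z.
Proof. by move=> /andP[k0 kp]; rewrite dvdzE /= gtnNdvd. Qed.

(** * Integral kernel vectors and vanishing determinants *)

Section Vanishing.

Variables (p : nat) (c d : int).
Hypotheses (p_pr : prime p) (p_odd : odd p).

Local Notation F := 'F_p.

Let p_gt2 : (2 < p)%N.
Proof. by move: p_pr p_odd; case: (p) => [|[|[|]]]. Qed.

Let p_half : p = (2 * p./2).+1.
Proof. by have := odd_double_half p; rewrite p_odd; lia. Qed.

Let intF0 (x : int) : (p %| x)%Z -> x%:~R = 0 :> F.
Proof. by rewrite -intFp_eq0 // => /eqP. Qed.

Lemma sum_legendre_power0 (k : int) i : (0 < i < p.-1)%N ->
  (p %| quad_coef p c d (p.-1 - i))%Z ->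
  \sum_(j < p) j%:R ^+ i * (legendre (qform c d j k) p)%:~R = 0 :> F.
Proof.
move=> Hi /intF0 E; rewrite sum_legendre_power //; last by lia.
by rewrite E oppr0 mul0r sub0r ifN ?oppr0 //; lia.
Qed.

(** The sum equals [-(d^m + 1)] with [m = (p - 1) / 2], from the constant and leading coefficients;
    the condition on [d] says that it is not a square modulo [p]. *)
Lemma sum_legendre_power_full (k : int) : ~~ (p %| k)%Z -> (p %| d ^+ p./2 + 1)%Z ->
  \sum_(j < p) j%:R ^+ p.-1 * (legendre (qform c d j k) p)%:~R = 0 :> F.
Proof.
move=> pk /intF0 E; rewrite sum_legendre_power //; last by lia.
rewrite subnn quad_coef0 eqxx quad_coef_lead // fermat_Fp ?intFp_eq0 //.
by rewrite mulr1 -opprD -rmorphD /= E oppr0.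
Qed.

Lemma det0_composite (u : nat -> int) m : coprime p m -> (2 < m)%N ->
  u 0%N = 0 -> (exists2 s, (s < p)%N & u s != 0) ->
  (forall k : int, \sum_(s < p) u s * legendre (qform c d s k) p = 0) ->
  jacobi_det c d (p * m) = 0.
Proof.
move=> cop m2 u0 [s sp us] H; rewrite -[LHS]intz.
apply: (det_kernel_vec (v := crt_vec p m 0 u)).
  apply: crt_kernel_vec => //; [by lia | by right; lia | move=> k _].
  by rewrite -[RHS](H k); apply: eq_bigr => j _; rewrite intz.
have [j [jn _ vj]] := crt_vec_neq0 (prime_gt0 p_pr) cop (ltnW (ltnW m2)) sp us.
by exists j.
Qed.

Lemma det0_prime (u : nat -> int) : u 0%N = 0 -> u 1%N = 0 -> u p.-1 = 0 ->
  (exists2 s, (s < p)%N & u s != 0) ->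
  (forall k : nat, (1 < k < p.-1)%N -> \sum_(s < p) u s * legendre (qform c d s k) p = 0) ->
  jacobi_det c d p = 0.
Proof.
move=> u0 u1 up [s sp us] H; rewrite -[LHS]intz -[p in jacobi_det _ _ p]muln1.
apply: (det_kernel_vec (v := crt_vec p 1 0 u)).
  apply: crt_kernel_vec; rewrite ?coprimen1 //; [by left | rewrite muln1 => k Hk].
  by rewrite -[RHS](H k Hk); apply: eq_bigr => j _; rewrite intz.
have [j [jn _ vj]] := crt_vec_neq0 (prime_gt0 p_pr) (coprimen1 p) (ltn0Sn 0) sp us.
by exists j.
Qed.

Lemma legendre_sum_half (k : int) : (p %| quad_coef p c d p./2)%Z ->
  \sum_(s < p) legendre s%:Z p * legendre (qform c d s k) p = 0.
Proof.
move=> pa; apply: (@sum_signs_eq0 _ p_pr p_odd (fun s => legendre s%:Z p)) => //.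
- by rewrite /legendre dvdz0.
- by move=> s; rewrite /legendre; case: ifP => // _; case: ifP.
have Hm : (p.-1 - p./2 = p./2)%N by lia.
have Hi : (0 < p./2 < p.-1)%N by lia.
rewrite -{}Hm in pa; rewrite -[RHS](sum_legendre_power0 k Hi pa).
by apply: eq_bigr => s _; rewrite legendre_euler // -pmulrn.
Qed.

Lemma legendre1 : legendre 1 p = 1.
Proof.
rewrite /legendre ifN; last by apply/negP => /dvdn_leq; lia.
have p1 : (1 < p)%N by lia.
by case: existsP => // -[]; exists (Ordinal p1).
Qed.

Lemma det0_half_composite m : coprime p m -> (2 < m)%N ->
  (p %| quad_coef p c d p./2)%Z -> jacobi_det c d (p * m) = 0.
Proof.
move=> cop m2 pa; apply: (@det0_composite (fun s => legendre s%:Z p)) => //.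
- by rewrite /legendre dvdz0.
- by exists 1%N; [lia | rewrite legendre1].
by move=> k; apply: legendre_sum_half.
Qed.

Lemma legendre_opp1 : (p %% 4 = 1)%N -> legendre p.-1%:Z p = 1.
Proof.
move=> p4; have E : (legendre p.-1%:Z p)%:~R = 1 :> F.
  rewrite legendre_euler // -pmulrn -subn1 natrB ?prime_gt0 // pchar_Fp_0 // sub0r.
  by rewrite -signr_odd (_ : odd p./2 = false) //; lia.
move: E; rewrite /legendre; case: ifP => [_ /eqP|_]; first by rewrite eq_sym oner_eq0.
case: ifP => // _ /eqP; rewrite rmorphN1 eq_sym -addr_eq0 -(natrD _ 1 1) natFp_eq0 //.
by move=> /dvdn_leq; lia.
Qed.

Lemma exists_legendre_N1 : exists2 s, (s < p)%N & legendre s%:Z p = -1.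
Proof.
have [|j [Hj nj]] := @exists_expr_neq1 _ p_pr p_odd p./2; first by lia.
exists j; first by lia.
move: nj; rewrite /legendre; case: ifP => [/dvdn_leq|_]; first by lia.
have := @legendre_euler _ p_pr p_odd j; rewrite /legendre; case: ifP => [/dvdn_leq|_]; first
  by lia.
by case: ifP => // _ <-; rewrite eqxx.
Qed.

(** The Legendre symbol is 1 at both 1 and -1, since -1 is a square. Subtracting it from the
    indicator of the nonzero classes gives zeros there, and the value 2 at nonsquares. *)
Lemma det0_half_prime : (p %% 4 = 1)%N -> (p %| quad_coef p c d p./2)%Z ->
  (p %| d ^+ p./2 + 1)%Z -> jacobi_det c d p = 0.
Proof.
move=> p4 pa pd; pose u s : int := (s != 0%N)%:Z - legendre s%:Z p.
apply: (@det0_prime u); rewrite /u.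
- by rewrite /legendre dvdz0.
- by rewrite legendre1.
- by rewrite legendre_opp1 // (_ : p.-1 != 0%N) //; lia.
- have [s sp sN] := exists_legendre_N1; exists s => //; rewrite sN.
  by case: (s != 0%N).
move=> k Hk; under eq_bigr => s _ do rewrite mulrBl.
rewrite sumrB legendre_sum_half // subr0.
apply: (@sum_signs_eq0 _ p_pr p_odd (fun s => (s != 0%N)%:Z)) => //; first by move=> s;
  case: eqP.
have pk : ~~ (p %| k%:Z)%Z by apply: ndvdz_lt; lia.
rewrite -[RHS](sum_legendre_power_full pk pd).
apply: eq_bigr => s _; congr (_ * _); have [->|s0] := eqVneq (s : nat) 0%N.
  by rewrite expr0n (_ : p.-1 == 0%N = false) //; lia.
by rewrite fermat_Fp ?natFp_eq0 //; apply/negP => /dvdn_leq; have := ltn_ord s; lia.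
Qed.

End Vanishing.

(** * Roots of unity and power functions modulo [p] *)

Section PowerKernels.

Variables (p : nat) (c d : int).
Hypotheses (p_pr : prime p) (p_odd : odd p).

Local Notation F := 'F_p.

Let p_gt2 : (2 < p)%N.
Proof. by move: p_pr p_odd; case: (p) => [|[|[|]]]. Qed.

Let p_half : p = (2 * p./2).+1.
Proof. by have := odd_double_half p; rewrite p_odd; lia. Qed.

Lemma natFp_neq0 s : (0 < s < p)%N -> s%:R != 0 :> F.
Proof. by move=> Hs; rewrite natFp_eq0 //; apply/negP => /dvdn_leq; lia. Qed.

Lemma natFp_pred : p.-1%:R = -1 :> F.
Proof. by rewrite -subn1 natrB ?prime_gt0 // pchar_Fp_0 // sub0r. Qed.

Lemma expr_natFp_pred i : (p.-1%:R ^+ i) ^+ 2 = 1 :> F.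
Proof. by rewrite natFp_pred exprAC sqrrN !expr1n. Qed.

(* With [z] a primitive [r]-th root of unity, [u s] is the difference of the
   indicators of [s ^ i = z] and [s ^ i = z^-1]; its values are signs, and
   modulo [p] it is a combination of [s ^ i] and [s ^ (p - 1 - i)]. *)
Lemma det0_root r i m : r = 3%N \/ r = 4%N -> (r * i = p.-1)%N ->
  (p %| quad_coef p c d i)%Z -> (p %| quad_coef p c d (p.-1 - i))%Z ->
  coprime p m -> m = 1%N \/ (2 < m)%N -> jacobi_det c d (p * m) = 0.
Proof.
move=> Hr Hri pa pa' cop Hm.
have Hi : (0 < i < p.-1)%N by case: Hr Hri => ->; lia.
have Hi' : (0 < p.-1 - i < p.-1)%N by lia.
(* Excluding [z^2 = 1] makes [z = g^i] a primitive [r]-th root of unity for both values of [r]. *)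
have [|g [Hg ng]] := @exists_expr_neq1 _ p_pr p_odd (i * 2).
  by case: Hr Hri => ->; lia.
pose z : F := g%:R ^+ i; rewrite exprM -/z in ng.
have g0 := natFp_neq0 Hg.
have z0 : z != 0 by rewrite expf_neq0.
have root_pow s : (0 < s < p)%N -> (s%:R ^+ i) ^+ r = 1 :> F.
  by move=> Hs; rewrite -exprM mulnC Hri fermat_Fp ?natFp_neq0.
have zr : z ^+ r = 1 by apply: root_pow.
have zV : z != z^-1 by apply: contra_neq ng => E; rewrite expr2 {2}E mulfV.
have z1 : z != 1 by apply: contra_neq ng => ->; rewrite expr1n.
pose u s : int := (s%:R ^+ i == z :> F)%:Z - (s%:R ^+ i == z^-1 :> F)%:Z.
have uE s : (s < p)%N -> (u s)%:~R = (s%:R ^+ i - s%:R ^+ (p.-1 - i)) / (z - z^-1) :> F.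
  case: (posnP s) => [-> _|s0 sp].
    rewrite /u expr0n [in RHS]expr0n !gtn_eqF ?(eq_sym 0) ?invr_eq0 ?(negPf z0); try by lia.
    by rewrite !subrr mul0r.
  have Hs : (0 < s < p)%N by rewrite s0.
  have nzs := natFp_neq0 Hs; pose y : F := s%:R ^+ i; have y0 : y != 0 by rewrite expf_neq0.
  have -> : s%:R ^+ (p.-1 - i) = y^-1 :> F.
    by apply: (mulfI y0); rewrite mulfV // -exprD subnKC ?fermat_Fp //; lia.
  rewrite /u -/y; have yr : y ^+ r = 1 by apply: root_pow.
  have dz : z - z^-1 != 0 by rewrite subr_eq0.
  have [->|yz] := eqVneq y z; first by rewrite (negPf zV) subr0 mulfV.
  have [->|yzV] := eqVneq y z^-1; first by rewrite invrK -[z^-1 - z]opprB mulNr mulfV.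
  (* The remaining [r]-th roots of unity are 1, and -1 if [r = 4]; multiplying by [(y - z)(y - 1/z)]
     makes this a polynomial identity. *)
  suff -> : y^-1 = y by rewrite !subrr mul0r.
  apply: (mulfI y0); rewrite mulfV //; apply/esym/eqP; rewrite -subr_eq0.
  have nyz : (y - z) * (y - z^-1) != 0 by rewrite mulf_neq0 ?subr_eq0.
  apply/eqP; apply: (mulfI nyz); rewrite mulr0.
  case: Hr zr yr => -> zr yr.
    have : (z - 1) * (z ^+ 2 + z + 1) = 0.
      by transitivity (z ^+ 3 - 1); [ring | rewrite zr subrr].
    move=> /eqP; rewrite mulf_eq0 subr_eq0 (negPf z1) /= => /eqP zz.
    have -> : z^-1 = - 1 - z.
      by apply: (mulfI z0); rewrite mulfV // -[LHS]subr0 -[X in _ - X = _]zz; ring.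
    have -> : (y - z) * (y - (-1 - z)) * (y * y - 1) =
        (y + 1) * (y ^+ 3 - 1) - (z ^+ 2 + z + 1) * (y ^+ 2 - 1) by ring.
    by rewrite zz yr; ring.
  have : (z ^+ 2 - 1) * (z ^+ 2 + 1) = 0.
    by transitivity (z ^+ 4 - 1); [ring | rewrite zr subrr].
  move=> /eqP; rewrite mulf_eq0 subr_eq0 (negPf ng) /= => /eqP zz.
  have -> : z^-1 = - z.
    by apply: (mulfI z0); rewrite mulfV // -[LHS]subr0 -[X in _ - X = _]zz; ring.
  have -> : (y - z) * (y - - z) * (y * y - 1) =
      (y ^+ 4 - 1) - (z ^+ 2 + 1) * (y ^+ 2 - 1) by ring.
  by rewrite zz yr; ring.
have u0 : u 0%N = 0.
  by rewrite /u expr0n gtn_eqF ?(eq_sym 0) ?invr_eq0 ?(negPf z0); lia.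
have u_sq1 s : (s%:R ^+ i) ^+ 2 = 1 :> F -> u s = 0.
  move=> E; have e1 : (s%:R ^+ i == z) = false.
    by apply: contraNF ng => /eqP <-; rewrite E.
  have e2 : (s%:R ^+ i == z^-1) = false.
    by apply: contraNF ng => /eqP e; rewrite -[z]invrK -e exprVn E invr1.
  by rewrite /u e1 e2.
have ker (k : int) : \sum_(s < p) u s * legendre (qform c d s k) p = 0.
  apply: (@sum_signs_eq0 _ p_pr p_odd) => // [s|].
    by rewrite /u; case: eqP; case: eqP.
  have pa2 : (p %| quad_coef p c d (p.-1 - (p.-1 - i)))%Z by rewrite subKn //; lia.
  have E1 := sum_legendre_power0 p_pr p_odd k Hi pa'.
  have E2 := sum_legendre_power0 p_pr p_odd k Hi' pa2.
  under eq_bigr => s _ do rewrite uE // mulrAC mulrBl.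
  by rewrite -mulr_suml sumrB E1 E2 subrr mul0r.
have us : exists2 s, (s < p)%N & u s != 0.
  by exists g; [lia | rewrite /u -/z eqxx (negPf zV)].
case: Hm => [->|m2]; last exact: (det0_composite p_pr p_odd cop m2 u0 us ker).
rewrite muln1; apply: (det0_prime p_pr u0 _ _ us).
- by apply: u_sq1; rewrite !expr1n.
- by apply: u_sq1; rewrite expr_natFp_pred.
by move=> k _; apply: ker.
Qed.

Lemma dvd_det_kernel_vec n (v : nat -> F) : kernel_vec n c d v ->
  (exists2 j, (j < n)%N & v j != 0) -> (p %| jacobi_det c d n)%Z.
Proof. by move=> kv vn; rewrite -intFp_eq0 // (det_kernel_vec kv vn). Qed.

Lemma power_kernel_vec i m a : (0 < i < p.-1)%N -> (p %| quad_coef p c d (p.-1 - i))%Z ->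
  coprime p m -> (a < m)%N -> ((1 < m) && (a != 1) && (a != m.-1))%N ->
  kernel_vec (p * m) c d (crt_vec p m a (fun s => s%:R ^+ i : F)).
Proof.
move=> Hi pa cop am Ha; apply: crt_kernel_vec => //; last 1 first.
- by move=> k _; apply: sum_legendre_power0.
- by rewrite expr0n gtn_eqF //; lia.
by right.
Qed.

Lemma power_vec_neq0 i m a : coprime p m -> (a < m)%N ->
  exists j, [/\ (j < p * m)%N, (j %% m = a)%N & crt_vec p m a (fun s => s%:R ^+ i : F) j != 0].
Proof.
move=> cop am; apply: (@crt_vec_neq0 _ p m a _ 1%N); rewrite ?prime_gt0 ?prime_gt1 //.
by rewrite expr1n oner_neq0.
Qed.

Lemma dvd_det_composite i m : (0 < i < p.-1)%N -> (p %| quad_coef p c d (p.-1 - i))%Z ->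
  coprime p m -> (2 < m)%N -> (p %| jacobi_det c d (p * m))%Z.
Proof.
move=> Hi pa cop m2; have am : (0 < m)%N by lia.
have Ha : ((1 < m) && (0 != 1) && (0 != m.-1))%N by lia.
apply: (dvd_det_kernel_vec (power_kernel_vec Hi pa cop am Ha)).
by have [j [jn _ vj]] := power_vec_neq0 i cop am; exists j.
Qed.

(** For [m > 4] the classes 0 and 2 both avoid 1 and -1 modulo [m], and the same power function
    placed on each gives two vectors with disjoint supports. *)
Lemma dvd_sq_det_composite i m : (0 < i < p.-1)%N -> (p %| quad_coef p c d (p.-1 - i))%Z ->
  coprime p m -> (4 < m)%N -> (p%:Z ^+ 2 %| jacobi_det c d (p * m))%Z.
Proof.
move=> Hi pa cop m4; have am : (0 < m)%N by lia.
have bm : (2 < m)%N by lia.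
have Ha : ((1 < m) && (0 != 1) && (0 != m.-1))%N by lia.
have Hb : ((1 < m) && (2 != 1) && (2 != m.-1))%N by lia.
have [j1 [j1n j1a vj1]] := power_vec_neq0 i cop am.
have [j2 [j2n _ wj2]] := power_vec_neq0 i cop bm.
apply: (dvd_sq_det_kernel_vec p_pr (power_kernel_vec Hi pa cop am Ha)
  (power_kernel_vec Hi pa cop bm Hb) j1n j2n vj1 _ wj2).
by rewrite /crt_vec j1a.
Qed.

Lemma kernel_vec_prime (u : nat -> F) : u 0%N = 0 -> u 1%N = 0 -> u p.-1 = 0 ->
  (forall k, (1 < k < p.-1)%N ->
     \sum_(s < p) u s * (legendre (qform c d s k%:Z) p)%:~R = 0) ->
  kernel_vec p c d (crt_vec p 1 0 u).
Proof.
move=> u0 u1 up H; rewrite -[X in kernel_vec X]muln1.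
by apply: crt_kernel_vec; rewrite ?coprimen1 ?muln1 //; left.
Qed.

Lemma crt_vec_prime (u : nat -> F) j : (j < p)%N -> crt_vec p 1 0 u j = u j.
Proof. by move=> jp; rewrite /crt_vec modn1 modn_small. Qed.

(** The exponents [i] and [p - 1 - i] have equal parity, so the difference of the two powers
    vanishes at -1 as well as at 1; it is nonzero at any [g] with [g^(2i) != 1]. *)
Lemma dvd_det_prime i : (0 < i)%N -> (2 * i < p.-1)%N ->
  (p %| quad_coef p c d i)%Z -> (p %| quad_coef p c d (p.-1 - i))%Z ->
  (p %| jacobi_det c d p)%Z.
Proof.
move=> i0 i2 pa pa'; pose u s : F := s%:R ^+ i - s%:R ^+ (p.-1 - i).
have Hi : (0 < i < p.-1)%N by lia.
have Hi' : (0 < p.-1 - i < p.-1)%N by lia.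
have pa2 : (p %| quad_coef p c d (p.-1 - (p.-1 - i)))%Z by rewrite subKn //; lia.
have kv : kernel_vec p c d (crt_vec p 1 0 u).
  apply: kernel_vec_prime; rewrite /u.
  - by rewrite !expr0n !gtn_eqF ?subrr //; lia.
  - by rewrite !expr1n subrr.
  - rewrite natFp_pred -(signr_odd _ i) -(signr_odd _ (_ - _)).
    have -> : odd (p.-1 - i) = odd i by lia.
    by rewrite subrr.
  move=> k _; under eq_bigr => s _ do rewrite mulrBl.
  by rewrite sumrB !sum_legendre_power0 ?subrr.
apply: (dvd_det_kernel_vec kv).
have [|g [Hg ng]] := @exists_expr_neq1 _ p_pr p_odd (2 * i); first by lia.
have gp : (g < p)%N by lia.
exists g => //; rewrite crt_vec_prime //; apply: contra_neq ng => /eqP.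
rewrite /u subr_eq0 => /eqP E;
  rewrite mul2n -addnn exprD {1}E -exprD subnK ?fermat_Fp ?natFp_neq0 //.
lia.
Qed.

(* The kernel contains the functions spanned by [1], [s^i] and [s^-i] that
   vanish at [1]; [w] is the one that also vanishes at [s = g]. *)
Lemma dvd_sq_det_prime i : (0 < i)%N -> ~~ odd i -> (2 * i < p.-1)%N ->
  (p %| quad_coef p c d i)%Z -> (p %| quad_coef p c d (p.-1 - i))%Z ->
  (p %| d ^+ p./2 + 1)%Z -> (p%:Z ^+ 2 %| jacobi_det c d p)%Z.
Proof.
move=> i0 iev i2 pa pa' pd.
have Hi : (0 < i < p.-1)%N by lia.
have Hi' : (0 < p.-1 - i < p.-1)%N by lia.
have pa2 : (p %| quad_coef p c d (p.-1 - (p.-1 - i)))%Z by rewrite subKn //; lia.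
have [|g [Hg ng]] := @exists_expr_neq1 _ p_pr p_odd i; first by lia.
pose y : F := g%:R ^+ i.
pose comb (a b e : F) s : F := a * s%:R ^+ p.-1 + b * s%:R ^+ i + e * s%:R ^+ (p.-1 - i).
have kv a b e : a + b + e = 0 -> kernel_vec p c d (crt_vec p 1 0 (comb a b e)).
  move=> E; apply: kernel_vec_prime; rewrite /comb.
  - by rewrite !expr0n !gtn_eqF ?mulr0 ?addr0 //; lia.
  - by rewrite !expr1n !mulr1.
  - rewrite natFp_pred -(signr_odd _ i) -(signr_odd _ p.-1) -(signr_odd _ (_ - _)).
    have o1 : odd p.-1 = false by lia.
    have o2 : odd (p.-1 - i) = false by lia.
    by rewrite (negPf iev) o1 o2 !expr0 !mulr1.
  move=> k Hk; under eq_bigr => s _ do rewrite !mulrDl -!mulrA.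
  have pk : ~~ (p %| k%:Z)%Z by apply: ndvdz_lt; lia.
  rewrite !big_split -!mulr_sumr (sum_legendre_power_full c p_pr p_odd pk pd).
  by rewrite !sum_legendre_power0 //= !mulr0 !addr0.
(* Multiplied by [x = s^i], a combination becomes a quadratic polynomial in [x]. *)
have combE a b e s : (0 < s < p)%N -> s%:R ^+ i * comb a b e s =
    b * (s%:R ^+ i) ^+ 2 + a * s%:R ^+ i + e.
  move=> Hs; have ns := natFp_neq0 Hs; rewrite /comb fermat_Fp //.
  have : s%:R ^+ i * s%:R ^+ (p.-1 - i) = 1 :> F.
    by rewrite -exprD subnKC ?fermat_Fp //; lia.
  move: (s%:R ^+ i) (s%:R ^+ (p.-1 - i)) => x x' xx.
  by rewrite !mulrDr (mulrCA x e) xx; ring.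
have gp : (g < p)%N by lia.
have ng0 := expf_neq0 i (natFp_neq0 Hg).
(* Its degree [2i] is less than [p - 1], so some nonzero [h] is not a root; [w] will be nonzero
   there. *)
pose Q : {poly F} := ('X^i - 1) * ('X^i - y%:P).
have [||h [Hh nh]] := @exists_nonroot _ p_pr p_odd Q.
- by rewrite mulf_neq0 // monic_neq0 ?monic_Xn_sub_1 ?monicXnsubC.
- rewrite size_Mmonic ?monic_neq0 ?monic_Xn_sub_1 ?monicXnsubC //.
  by rewrite size_Xn_sub_1 // size_XnsubC //; lia.
have hp : (h < p)%N by lia.
have {}nh : (h%:R ^+ i - 1) * (h%:R ^+ i - y) != 0 by move: nh; rewrite /Q !hornerE.
(* In terms of [x] these are [-x(x - 1)] and [-(x - 1)(x - y)]. *)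
have kv1 := kv 1 (-1) 0; have kv2 := kv (1 + y) (-1) (- y).
apply: (dvd_sq_det_kernel_vec p_pr (kv1 _) (kv2 _) gp hp).
- by rewrite addr0 subrr.
- by ring.
- rewrite crt_vec_prime //; apply: contra_neq ng => E.
  have := combE 1 (-1) 0 g Hg; rewrite E mulr0 => /esym/eqP.
  rewrite addr0 mulN1r mul1r -[X in _ + X]mulr1 addrC expr2 -mulrBr mulf_eq0 (negPf ng0) /=.
  by rewrite subr_eq0 => /eqP.
- rewrite crt_vec_prime //; apply: (mulfI ng0); rewrite combE // mulr0 -/y.
  by ring.
rewrite crt_vec_prime //; apply: contra_neq nh => E.
have := combE (1 + y) (-1) (- y) h Hh; rewrite E mulr0 => E2.
by rewrite -[RHS]oppr0 E2; ring.
Qed.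

End PowerKernels.

(** * Prime divisors and sums of two squares *)

Lemma mul_prime_ind (S : nat -> Prop) : S 1%N ->
  (forall a b, S a -> S b -> S (a * b)%N) ->
  forall n, (0 < n)%N -> (forall p, prime p -> (p %| n)%N -> S p) -> S n.
Proof.
move=> S1 SM n; elim/ltn_ind: n => n IHn n0 H.
have [n1|n1] := leqP n 1; first by rewrite (_ : n = 1%N) //; lia.
have pn := pdiv_dvd n; have p_pr := pdiv_prime n1; have p1 := prime_gt1 p_pr.
rewrite -(divnK pn); apply: SM; last exact: H.
apply: IHn; first by apply: ltn_Pdiv.
  by rewrite divn_gt0 ?prime_gt0 // dvdn_leq.
by move=> q q_pr /dvdn_trans qn; apply: H => //; apply: qn; rewrite dvdn_div.
Qed.

Lemma exists_prime_divisor (b : pred nat) n : b 1%N ->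
  (forall x y, b x -> b y -> b (x * y)%N) -> (0 < n)%N -> ~~ b n ->
  exists p, [/\ prime p, (p %| n)%N & ~~ b p].
Proof.
move=> b1 bM n0 bn; have [/allP H|/allPn[p]] := boolP (all b (primes n)); last first.
  by rewrite mem_primes n0 /= => /andP[p_pr pn] bp; exists p.
case/negP: bn; apply: (mul_prime_ind (S := b)) => // p p_pr pn; apply: H.
by rewrite mem_primes p_pr n0.
Qed.

Lemma exists_floor_sqrt n : exists k, (k ^ 2 <= n < k.+1 ^ 2)%N.
Proof.
elim: n => [|n [k /andP[k1 k2]]]; first by exists 0%N.
case: (ltnP n.+1 (k.+1 ^ 2)) => h; [exists k | exists k.+1]; nia.
Qed.

Lemma sum_of_two_squaresM a b :
  sum_of_two_squares a -> sum_of_two_squares b -> sum_of_two_squares (a * b).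
Proof.
move=> [x [y Ea]] [z [t Eb]]; exists (x * z - y * t), (x * t + y * z).
by rewrite PoszM Ea Eb; ring.
Qed.

(* Thue's lemma: the pigeonhole principle applied to [a + b x], where
   [x ^ 2 = -1] modulo [p] and [a, b <= sqrt p]. *)
Lemma prime_sum_of_two_squares p : prime p -> (p %% 4 = 1)%N -> sum_of_two_squares p.
Proof.
move=> p_pr p4; have p_odd : odd p by lia.
have p1 := prime_gt1 p_pr.
have [|g [Hg ng]] := @exists_expr_neq1 _ p_pr p_odd p./2; first by lia.
pose x : 'F_p := g%:R ^+ (p %/ 4).
have x2 : x ^+ 2 = -1.
  have : (x ^+ 2) ^+ 2 = 1.
    have -> : (x ^+ 2) ^+ 2 = g%:R ^+ p.-1 by rewrite /x -!exprM; congr (_ ^+ _); lia.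
    by rewrite fermat_Fp ?natFp_neq0.
  move=> /eqP; rewrite sqrf_eq1 => /orP[/eqP E|/eqP //].
  have E2 : x ^+ 2 = g%:R ^+ p./2 by rewrite /x -exprM; congr (_ ^+ _); lia.
  by rewrite -E2 E eqxx in ng.
have [k /andP[k1 k2]] := exists_floor_sqrt p.
have {}k1 : (k ^ 2 < p)%N.
  rewrite ltn_neqAle k1 andbT; apply: contraTneq p_pr => <-.
  by rewrite -mulnn; apply/negP => /primeP[_ /(_ k)]; rewrite dvdn_mulr // => /(_ isT); nia.
pose f (ab : 'I_k.+1 * 'I_k.+1) : 'F_p := (ab.1 : nat)%:R + (ab.2 : nat)%:R * x.
have : ~~ injectiveb f.
  apply/negP => /injectiveP /leq_card; rewrite card_prod !card_ord Fp_cast //.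
  by nia.
case/injectivePn => -[a b] [[a' b'] nab]; rewrite /f /= => E.
pose X : int := (a : nat)%:Z - (a' : nat)%:Z; pose Y : int := (b : nat)%:Z - (b' : nat)%:Z.
have XY : X%:~R = - (Y%:~R * x) :> 'F_p.
  rewrite /X /Y !rmorphB /= -!pmulrn; apply/eqP; rewrite -addr_eq0; apply/eqP.
  transitivity (((a : nat)%:R + (b : nat)%:R * x) - ((a' : nat)%:R + (b' : nat)%:R * x)).
    by ring.
  by rewrite E subrr.
have pXY : (p %| X ^+ 2 + Y ^+ 2)%Z.
  by rewrite -intFp_eq0 // rmorphD !rmorphXn /= XY sqrrN exprMn x2 mulrN1 addNr.
exists X, Y.
have ak := ltn_ord a; have a'k := ltn_ord a'.
have bk := ltn_ord b; have b'k := ltn_ord b'.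
have sq_le (u v : nat) : (u < k.+1)%N -> (v < k.+1)%N -> (u%:Z - v%:Z) ^+ 2 <= (k ^ 2)%:Z.
  move=> uk vk; rewrite -subr_ge0 expnS expn1 PoszM.
  rewrite (_ : _ - _ = (k%:Z - (u%:Z - v%:Z)) * (k%:Z + (u%:Z - v%:Z))); last by ring.
  by rewrite mulr_ge0 //; lia.
have X2 := sq_le _ _ ak a'k; have Y2 := sq_le _ _ bk b'k; rewrite -/X -/Y in X2 Y2.
have : X ^+ 2 + Y ^+ 2 != 0.
  apply: contraNneq nab => /eqP; rewrite paddr_eq0 ?sqr_ge0 // !expf_eq0 /= !subr_eq0.
  by rewrite !eqz_nat => /andP[/eqP/val_inj -> /eqP/val_inj ->].
case/dvdzP: pXY => q; move: X2 Y2; set s := X ^+ 2; set t := Y ^+ 2.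
have s0 : 0 <= s by rewrite sqr_ge0.
have t0 : 0 <= t by rewrite sqr_ge0.
move=> X2 Y2 E1 E0; have q0 : 0 < q.
  have : 0 < q * p%:Z by rewrite -E1 lt_def E0 addr_ge0.
  by rewrite pmulr_lgt0 //; lia.
have q2 : q < 2.
  rewrite -(@ltr_pM2r _ p%:Z) -?E1; last by lia.
  by move: X2 Y2 k1; move: (k ^ 2)%N => K2; lia.
by rewrite E1 (_ : q = 1) ?mul1r //; lia.
Qed.

Lemma sum_of_two_squares_prime3 n p : sum_of_two_squares n -> prime p ->
  (p %% 4 = 3)%N -> (p %| n)%N -> (p ^ 2 %| n)%N.
Proof.
move=> [x [y E]] p_pr p4 pn; have p_odd : odd p by lia.
have p1 := prime_gt1 p_pr.
have E0 : x%:~R ^+ 2 + y%:~R ^+ 2 = 0 :> 'F_p.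
  by rewrite -!rmorphXn -rmorphD /= -E; apply/eqP; rewrite intFp_eq0.
have y0 : y%:~R = 0 :> 'F_p.
  apply/eqP; apply: contraT => ny.
  have : (x%:~R / y%:~R) ^+ 2 = -1 :> 'F_p.
    by rewrite expr_div_n; apply: (mulIf (expf_neq0 2 ny)); rewrite mulfVK ?expf_neq0 //
      mulN1r; apply/eqP; rewrite -addr_eq0 E0.
  move=> /(congr1 (fun z => z ^+ p./2)); rewrite -exprM -signr_odd.
  have -> : odd p./2 by lia.
  have xy0 : x%:~R / y%:~R != 0 :> 'F_p.
    rewrite mulf_neq0 ?invr_eq0 //; apply: contraNneq ny => x0.
    by move: E0; rewrite x0 expr0n add0r => /eqP; rewrite expf_eq0.
  rewrite (_ : 2 * p./2 = p.-1)%N ?fermat_Fp //; last by lia.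
  by rewrite expr1 => /eqP; rewrite -addr_eq0 -(natrD _ 1 1) natFp_eq0 // => /dvdn_leq; lia.
have x0 : x%:~R = 0 :> 'F_p.
  by apply/eqP; move/eqP: E0; rewrite y0 expr0n addr0 expf_eq0.
have /dvdzP[u Eu] : (p %| x)%Z by rewrite -intFp_eq0 // x0.
have /dvdzP[v Ev] : (p %| y)%Z by rewrite -intFp_eq0 // y0.
have : (p%:Z ^+ 2 %| n%:Z)%Z.
  by apply/dvdzP; exists (u ^+ 2 + v ^+ 2); rewrite E Eu Ev; ring.
by rewrite dvdzE abszX.
Qed.

Lemma dvd_by_prime_parts e n (D : int) : (0 < n)%N ->
  (forall p, prime p -> (p %| n)%N -> D = 0 \/
     exists m, [/\ n = (p * m)%N, coprime p m & (p%:Z ^+ e %| D)%Z]) ->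
  (n%:Z ^+ e %| D)%Z.
Proof.
move=> n0 H; have [->|D0] := eqVneq D 0; first by rewrite dvdz0.
rewrite dvdzE abszX /=; apply/dvdn_partP; first by rewrite expn_gt0 n0.
move=> p; rewrite mem_primes => /and3P[p_pr _]; rewrite Euclid_dvdX // => /andP[pn _].
have [D00|[m [En cop pD]]] := H p p_pr pn; first by rewrite D00 eqxx in D0.
have m0 : (0 < m)%N by move: n0; rewrite En muln_gt0 => /andP[].
have l1 : logn p (p * m) = 1%N.
  have p0 := prime_gt0 p_pr; by rewrite lognM // (logn_coprime cop) addn0 logn_prime // eqxx.
by rewrite p_part lognX En l1 muln1; move: pD; rewrite dvdzE abszX.
Qed.

Lemma jacobi_dvd_eq0 x n p : prime p -> (0 < n)%N -> (p %| n)%N -> (p %| x)%Z -> jacobi x n = 0.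
Proof.
move=> p_pr n0 pn px; have pm : p \in primes n by rewrite mem_primes p_pr n0.
rewrite /jacobi (big_rem p) //= {1}/legendre px expr0n gtn_eqF ?mul0r //.
by rewrite logn_gt0.
Qed.

(** Row [j = p] is zero, because [p] divides each [p^2 + c p k + d k^2]; [p + 1 < n] places this row
    in the matrix. *)
Lemma det0_dvd_row c d n p : prime p -> odd n -> (p %| n)%N -> (p %| d)%Z ->
  (p.+1 < n)%N -> jacobi_det c d n = 0.
Proof.
move=> p_pr n_odd pn pd ltpn; have p1 := prime_gt1 p_pr.
have i1 : (p - 2 < n - 3)%N by lia.
rewrite jacobi_detE; apply/eqP/det0P; exists (delta_mx 0 (Ordinal i1)).
  apply/negP => /eqP/rowP/(_ (Ordinal i1)); rewrite !mxE !eqxx /=.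
  by move/eqP; rewrite oner_eq0.
rewrite -rowE; apply/rowP => l; rewrite !mxE; apply: (jacobi_dvd_eq0 p_pr) => //; first by lia.
rewrite /= (_ : (p - 2).+2 = p); last by lia.
have -> : qform c d p l.+2 = (p%:Z + c * l.+2%:Z) * p%:Z + l.+2%:Z ^+ 2 * d.
  by rewrite /qform; ring.
by rewrite rpredD // dvdz_mull.
Qed.

Lemma dvd_symbol p (d : int) : prime p ->
  (forall K : closedFieldType, p \in [pchar K] -> (d%:~R : K) ^+ p./2 = -1) ->
  (p %| d ^+ p./2 + 1)%Z.
Proof.
move=> p_pr H; have [K cK] := closed_field_pchar p_pr.
by rewrite (dvdz_pcharf cK) rmorphD rmorphXn /= H // addNr.
Qed.

(** * The families of determinants *)

Lemma ndvd_prime p l : prime p -> prime l -> p != l -> ~~ (p %| l%:Z)%Z.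
Proof. by move=> p_pr l_pr; rewrite dvdzE /= dvdn_prime2. Qed.

Lemma dvd_symbol_2 p : prime p -> odd p -> (p %% 8 \in [:: 3; 5])%N ->
  (p %| 2 ^+ p./2 + 1)%Z.
Proof.
move=> p_pr p_odd h; apply: dvd_symbol => // K cK; rewrite symbol_2 // ifN //.
by move: h; rewrite !inE; lia.
Qed.

Lemma dvd_symbol_8 p : prime p -> odd p -> (p %% 8 \in [:: 3; 5])%N ->
  (p %| 8 ^+ p./2 + 1)%Z.
Proof.
move=> p_pr p_odd h; apply: dvd_symbol => // K cK.
have -> : (8%:~R : K) = 2%:R ^+ 3 by ring.
rewrite exprAC symbol_2 // ifN; first by ring.
by move: h; rewrite !inE; lia.
Qed.

Lemma dvd_symbol_18 p : prime p -> odd p -> (p %% 24 = 19)%N ->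
  (p %| 18 ^+ p./2 + 1)%Z.
Proof.
move=> p_pr p_odd h; apply: dvd_symbol => // K cK.
have -> : (18%:~R : K) = 2%:R * ((- 3%:R) ^+ 2) by ring.
rewrite exprMn exprAC symbol_2 // symbol_N3 //; last by lia.
by rewrite ifN ?ifT ?expr1n ?mulr1 // ?inE; lia.
Qed.

Lemma dvd_symbol_3 p : prime p -> odd p -> (p %% 12 \in [:: 5; 7])%N ->
  (p %| 3 ^+ p./2 + 1)%Z.
Proof.
move=> p_pr p_odd h; apply: dvd_symbol => // K cK.
have -> : (3%:~R : K) = (- 1) * (- 3%:R) by ring.
rewrite exprMn symbol_N1 // symbol_N3 //; last by apply: contraTneq h => ->.
move: h; rewrite !inE => h.
have : (p %% 4 == 1)%N = (p %% 3 != 1)%N by lia.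
by case: ifP => _; case: ifP => //= _ _; rewrite ?mul1r ?mulr1.
Qed.

Lemma dvd_symbol_N7 p : prime p -> odd p -> (p %% 7 \in [:: 3; 5; 6])%N ->
  (p %| (- 7) ^+ p./2 + 1)%Z.
Proof.
move=> p_pr p_odd h; apply: dvd_symbol => // K cK.
rewrite symbol_N7 //; last by apply: contraTneq h => ->.
by rewrite ifN //; move: h; rewrite !inE; lia.
Qed.

Lemma dvd_symbol_112 p : prime p -> (p %% 4 = 1)%N -> (p %% 7 \in [:: 3; 5; 6])%N ->
  (p %| 112 ^+ p./2 + 1)%Z.
Proof.
move=> p_pr p4 h; have p_odd : odd p by lia.
apply: dvd_symbol => // K cK.
have -> : (112%:~R : K) = (- 1) * (- 7%:R) * 2%:R ^+ 4 by ring.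
rewrite exprMn exprMn [_ ^+ 4 ^+ _]exprAC symbol_N1 // p4 /= mul1r symbol_N7 //; last
  by apply: contraTneq h => ->.
rewrite ifN; last by move: h; rewrite !inE; lia.
by rewrite symbol_2 //; case: ifP => _; ring.
Qed.

Lemma det_3_2 n : odd n -> (n %% 4 = 1)%N -> ~ sum_of_two_squares n -> jacobi_det 3 2 n = 0.
Proof.
move=> n_odd n4 nS; have n0 : (0 < n)%N by lia.
have [/allP H|/allPn[p]] := boolP (all (fun p => p %% 4 == 1)%N (primes n)).
  case: nS; apply: mul_prime_ind => //.
  - by exists 1, 0; ring.
  - exact: sum_of_two_squaresM.
  move=> p p_pr pn; apply: prime_sum_of_two_squares => //; apply/eqP/H.
  by rewrite mem_primes p_pr n0.
rewrite mem_primes => /and3P[p_pr _ pn] p4; have p_odd := dvdn_odd pn n_odd.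
have {}p4 : (p %% 4 = 3)%N by lia.
case: (prime_divisor_split 3 2 p_pr n_odd pn) => // -[m [En cop]].
(* The prime [p] is 3 modulo 4 while [n] is 1, so [n] is not [p] itself. *)
case=> [m1|m2]; first by rewrite En m1 muln1 p4 in n4.
by rewrite En; apply: det0_half_composite => //; apply: dvd_quad_coef_3_2.
Qed.

Lemma det_2_2 p : prime p -> (p %% 24 = 13 \/ p %% 24 = 19)%N -> jacobi_det 2 2 p = 0.
Proof.
move=> p_pr h; have p_odd : odd p by lia.
have h24 : (p %% 24 \in [:: 13; 17; 19; 23])%N by rewrite !inE; lia.
have Ei : (3 * (2 * (p.-1 %/ 3)) = 2 * p.-1)%N by lia.
have pa := dvd_quad_coef_2_2 p_pr p_odd (or_introl Ei) h24.
have pa' : (p %| quad_coef p 2 2 (p.-1 - 2 * (p.-1 %/ 3)))%Z.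
  apply: dvd_quad_coef_sym => //; first by lia.
  by apply: (@ndvd_prime p 2) => //; lia.
have Ei' : (p.-1 - 2 * (p.-1 %/ 3) = p.-1 %/ 3)%N by lia.
have Ei2 : (2 * (p.-1 %/ 3) = p.-1 - p.-1 %/ 3)%N by lia.
rewrite Ei' in pa'; rewrite Ei2 in pa; rewrite -[p]muln1.
have E3 : (3 * (p.-1 %/ 3) = p.-1)%N by lia.
exact: (det0_root p_pr p_odd (or_introl erefl) E3 pa' pa (coprimen1 p) (or_introl erefl)).
Qed.

Lemma dvd_det_2_2 p : prime p -> (p %% 24 = 17 \/ p %% 24 = 23)%N ->
  (p %| jacobi_det 2 2 p)%Z.
Proof.
move=> p_pr h; have p_odd : odd p by lia.
have h24 : (p %% 24 \in [:: 13; 17; 19; 23])%N by rewrite !inE; lia.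
pose i := ((p - 2) %/ 3)%N.
have Ei : (3 * (p.-1 - i) = (2 * p).-1)%N by rewrite /i; lia.
have pa := dvd_quad_coef_2_2 p_pr p_odd (or_intror Ei) h24.
have Ei' : (p.-1 - (p.-1 - i) = i)%N by rewrite /i; lia.
have pa' : (p %| quad_coef p 2 2 i)%Z.
  rewrite -Ei'; apply: dvd_quad_coef_sym => //; first by lia.
  by apply: (@ndvd_prime p 2) => //; lia.
by apply: (dvd_det_prime p_pr p_odd _ _ pa' pa); rewrite /i; lia.
Qed.

Lemma det_disc8 c d n : odd n -> (n %% 8 = 5)%N ->
  (forall p, prime p -> odd p -> (p %% 8 \in [:: 5; 7])%N -> (p %| quad_coef p c d p./2)%Z) ->
  (forall p, prime p -> odd p -> (p %% 8 \in [:: 3; 5])%N -> (p %| d ^+ p./2 + 1)%Z) ->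
  jacobi_det c d n = 0.
Proof.
move=> n_odd n8 Ha Hd; have n0 : (0 < n)%N by lia.
(* Modulo an odd prime, -2 is a square exactly for the classes 1 and 3 modulo 8. *)
have [|||p [p_pr pn bp]] := @exists_prime_divisor (fun k => k %% 8 \in [:: 1; 3])%N n _ _ n0.
- by [].
- by move=> x y; rewrite !inE => /orP[] /eqP ex /orP[] /eqP ey; rewrite -modnMm ex ey.
- by rewrite n8.
have p_odd := dvdn_odd pn n_odd.
have p8 : (p %% 8 \in [:: 5; 7])%N by move: bp; rewrite !inE; lia.
case: (prime_divisor_split c d p_pr n_odd pn) => // -[m [En cop]].
case=> [m1|m2]; last by rewrite En; apply: det0_half_composite => //; apply: Ha.
have np : n = p by rewrite En m1 muln1.
rewrite np in n8 *; apply: det0_half_prime; rewrite ?Ha ?Hd ?n8 //; lia.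
Qed.

Lemma det_3_3 n : odd n -> (n %% 12 = 5)%N -> jacobi_det 3 3 n = 0.
Proof.
move=> n_odd n12; have n0 : (0 < n)%N by lia.
have [|||p [p_pr pn bp]] := @exists_prime_divisor (fun k => k %% 3 == 1)%N n _ _ n0.
- by [].
- by move=> x y /eqP ex /eqP ey; rewrite -modnMm ex ey.
- lia.
have p_odd := dvdn_odd pn n_odd.
have p3 : (p %% 3 = 2)%N.
  have : (p %% 3 != 0)%N.
    apply/negP; rewrite -/(dvdn 3 p) dvdn_prime2 // => /eqP p3.
    by move: pn; rewrite -p3; lia.
  lia.
case: (prime_divisor_split 3 3 p_pr n_odd pn) => // -[m [En cop]].
case=> [m1|m2]; last by rewrite En; apply: det0_half_composite => //; apply: dvd_quad_coef_3_3.
have np : n = p by rewrite En m1 muln1.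
rewrite np in n12 *; apply: det0_half_prime => //; first by lia.
  exact: dvd_quad_coef_3_3.
by apply: dvd_symbol_3; rewrite // n12.
Qed.

Lemma jacobi7_eqN1 n : jacobi n%:Z 7 = -1 -> (n %% 7 \in [:: 3; 5; 6])%N.
Proof.
rewrite /jacobi /= big_seq1 (_ : logn 7 7 = 1)%N // expr1 /legendre.
case: ifP => // n7; case: existsP => // nsq _.
have n70 : (n %% 7 != 0)%N by apply: contraFneq n7 => E; rewrite dvdzE /= /dvdn E.
have n7lt : (n %% 7 < 7)%N by rewrite ltn_mod.
have sq (x : 'I_7) : (n %% 7 != (x ^ 2) %% 7)%N.
  apply/negP => /eqP E; apply: nsq; exists x; apply/eqP.
  by rewrite -[_ ^+ 2]/((x : nat)%:Z * (x : nat)%:Z) -PoszM !modz_nat E mulnn.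
have := sq (@Ordinal 7 1 isT); have := sq (@Ordinal 7 2 isT); have := sq (@Ordinal 7 3 isT).
by rewrite !inE /=; move: n70 n7lt; case: (n %% 7)%N => [|[|[|[|[|[|[|]]]]]]].
Qed.

Lemma det_disc7 c d n : odd n -> (n %% 4 = 1)%N -> (n %% 7 \in [:: 3; 5; 6])%N ->
  (forall p, prime p -> odd p -> (p %% 7 \in [:: 3; 5; 6])%N ->
    (p %| quad_coef p c d p./2)%Z) ->
  (forall p, prime p -> (p %% 4 = 1)%N -> (p %% 7 \in [:: 3; 5; 6])%N ->
    (p %| d ^+ p./2 + 1)%Z) ->
  jacobi_det c d n = 0.
Proof.
move=> n_odd n4 n7 Ha Hd; have n0 : (0 < n)%N by lia.
have [|||p [p_pr pn bp]] := @exists_prime_divisor (fun k => k %% 7 \in [:: 1; 2; 4])%N n _ _ n0.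
- by [].
- by move=> x y; rewrite !inE => /or3P[] /eqP ex /or3P[] /eqP ey; rewrite -modnMm ex ey.
- by move: n7; rewrite !inE; lia.
have p_odd := dvdn_odd pn n_odd.
have p7 : (p %% 7 \in [:: 3; 5; 6])%N.
  have : (p %% 7 != 0)%N.
    apply/negP; rewrite -/(dvdn 7 p) dvdn_prime2 // => /eqP p7.
    by move: pn n7; rewrite -p7 !inE; lia.
  by move: bp; rewrite !inE; lia.
case: (prime_divisor_split c d p_pr n_odd pn) => // -[m [En cop]].
case=> [m1|m2]; last by rewrite En; apply: det0_half_composite => //; apply: Ha.
have np : n = p by rewrite En m1 muln1.
by rewrite np in n4 *; apply: det0_half_prime; rewrite ?Ha ?Hd.
Qed.

(** * Coefficients of degree two and three *)

Section SmallCoefficients.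

Variable p : nat.
Hypotheses (p_pr : prime p) (p_odd : odd p).

Local Notation F := 'F_p.

(* [Q = q ^ m] with [2 m = -1] satisfies [2 q Q' + q' Q = 0]. *)
Lemma quad_coef_relations (c d : int) :
  let a i : F := (quad_coef p c d i)%:~R in
  [/\ 2%:R * d%:~R * a 1%N + c%:~R * a 0%N = 0,
      4%:R * d%:~R * a 2%N + 3%:R * c%:~R * a 1%N + 2%:R * a 0%N = 0 &
      6%:R * d%:~R * a 3%N + 5%:R * c%:~R * a 2%N + 4%:R * a 1%N = 0].
Proof.
pose q : {poly F} := 'X^2 + (c%:~R)%:P * 'X + (d%:~R)%:P.
pose Q := q ^+ p./2; move=> a; have aE i : a i = Q`_i by rewrite /a quad_coef_intr.
have m0 : (0 < p./2)%N by have := prime_gt1 p_pr; lia.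
have ode : ((q * Q^`()) *+ 2 + ('X *+ 2 + (c%:~R)%:P) * Q)%R = 0.
  have -> : 'X *+ 2 + (c%:~R)%:P = q^`() by rewrite /q !derivE; ring.
  have -> : q * Q^`() = (q^`() * Q) *+ p./2.
    by rewrite /Q deriv_exp mulrnAr mulrCA -exprS prednK.
  rewrite -mulrnA -mulrSr -mulr_natr (_ : (p./2 * 2).+1 = p); last by have :=
    odd_double_half p; lia.
  by rewrite -polyC_natr pchar_Fp_0 // mulr0.
have dE i : (Q^`())`_i = a i.+1 *+ i.+1 by rewrite coef_deriv aE.
have eqn i : ((q * Q^`()) *+ 2 + ('X *+ 2 + (c%:~R)%:P) * Q)`_i = 0 by rewrite ode coef0.
have := eqn 0%N; have := eqn 1%N; have := eqn 2%N.
have -> : (q * Q^`()) *+ 2 + ('X *+ 2 + (c%:~R)%:P) * Q =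
   ('X^2 * Q^`() + (c%:~R)%:P * ('X * Q^`()) + (d%:~R)%:P * Q^`()) *+ 2 +
   ('X * Q) *+ 2 + (c%:~R)%:P * Q.
  by rewrite /q; ring.
rewrite !(coefD, coefMn, coefXnM, coefCM, coefXM, dE) /= -!aE => E2 E1 E0.
move: (a 0%N) (a 1%N) (a 2%N) (a 3%N) (c%:~R : F) (d%:~R : F) E0 E1 E2 =>
  a0 a1 a2 a3 c' d' E0 E1 E2.
by split; [rewrite -[RHS]E0 | rewrite -[RHS]E1 | rewrite -[RHS]E2 subnn]; ring.
Qed.

(** In general [8 d^2 a_2 = (3 c^2 - 4 d) a_0] modulo [p], and [3 c^2 = 4 d] for the pair
    [(2, 3)]. *)
Lemma dvd_quad_coef_2_3 : p != 3%N -> (p %| quad_coef p 2 3 2)%Z.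
Proof.
move=> p3; have [] := quad_coef_relations 2 3.
set a0 : F := (quad_coef _ _ _ 0)%:~R; set a1 : F := (quad_coef _ _ _ 1)%:~R.
rewrite -intFp_eq0 //; set a2 : F := (quad_coef _ _ _ 2)%:~R => E0 E1 _.
have : 2%:R ^+ 2 * 3%:R * a2 = 0.
  transitivity ((4%:R * 3%:~R * a2 + 3%:R * 2%:~R * a1 + 2%:R * a0) -
    (2%:R * 3%:~R * a1 + 2%:~R * a0)).
    by ring.
  by rewrite E0 E1 subrr.
have p2 : (p == 2%N) = false by apply: contraTF p_odd => /eqP ->.
by move=> /eqP; rewrite !mulf_eq0 !natFp_eq0 // !dvdn_prime2 // p2 (negPf p3) => /= /eqP ->.
Qed.

(** Elimination gives [48 d^3 a_3 = 3 c (12 d - 5 c^2) a_0] modulo [p], and [12 d = 5 c^2] for the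
    pair [(6, 15)]. *)
Lemma dvd_quad_coef_6_15 : (6 < p)%N -> (p %| quad_coef p 6 15 3)%Z.
Proof.
move=> p6; have [] := quad_coef_relations 6 15.
set a0 : F := (quad_coef _ _ _ 0)%:~R; set a1 : F := (quad_coef _ _ _ 1)%:~R.
set a2 : F := (quad_coef _ _ _ 2)%:~R.
rewrite -intFp_eq0 //; set a3 : F := (quad_coef _ _ _ 3)%:~R => E0 E1 E2.
have : 2%:R * 3%:R ^+ 2 * 5%:R * a3 = 0.
  transitivity ((6%:R * 15%:~R * a3 + 5%:R * 6%:~R * a2 + 4%:R * a1)
    - 2%:R^-1 * ((4%:R * 15%:~R * a2 + 3%:R * 6%:~R * a1 + 2%:R * a0)
    - 3%:R^-1 * (2%:R * 15%:~R * a1 + 6%:~R * a0))).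
    field; rewrite !natFp_eq0 // !dvdn_prime2 //; lia.
  by rewrite E0 E1 E2 !(mulr0, subr0).
have pl l : prime l -> (l < p)%N -> (p %| l)%N = false.
  by move=> l_pr lp; rewrite dvdn_prime2 //; lia.
have [p2 p3 p5] : [/\ (p %| 2) = false, (p %| 3) = false & (p %| 5) = false]%N.
  by split; apply: pl => //; lia.
by move=> /eqP; rewrite !mulf_eq0 !natFp_eq0 // p2 p3 p5 => /= /eqP ->.
Qed.

End SmallCoefficients.

(** For [p = 5] the exponent 2 is its own partner [p - 1 - 2]. As 3 is not a square modulo 5, [s^4]
    takes the place of the partner, and [3 (s^4 - s^2)] is the indicator of [{2, 3}]. *)
Lemma det_2_3_5 : jacobi_det 2 3 5 = 0.
Proof.
have a2 : (5 %| quad_coef 5 2 3 2)%Z by apply: dvd_quad_coef_2_3.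
pose u s : int := (s == 2%N)%:Z + (s == 3%N)%:Z.
apply: (@det0_prime 5 2 3 isT u) => //; first by exists 2%N.
move=> k Hk; apply: (@sum_signs_eq0 5 isT isT) => // [s|].
  by rewrite /u; case: eqVneq => [->|_]; case: eqP.
have uE (s : 'I_5) : (u s)%:~R = 3%:R * (s%:R ^+ 4 - s%:R ^+ 2) :> 'F_5.
  by case: s => [[|[|[|[|[|s]]]]] Hs] //; apply/val_inj.
under eq_bigr => s _ do rewrite uE -mulrA mulrBl.
have k5 : ~~ (5%:Z %| k%:Z)%Z by apply: ndvdz_lt; lia.
rewrite -mulr_sumr sumrB (@sum_legendre_power_full 5 2 3 isT isT _ k5) //.
by rewrite (@sum_legendre_power0 5 2 3 isT isT _ 2) // subrr mulr0.
Qed.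

Lemma det_2_3_dvd3 n : odd n -> (3 < n)%N -> (3 %| n)%N -> jacobi_det 2 3 n = 0.
Proof. by move=> n_odd n3 d3; apply: (@det0_dvd_row _ _ _ 3) => //; lia. Qed.

Lemma dvd_det_2_3 n : odd n -> (3 < n)%N -> (n%:Z %| jacobi_det 2 3 n)%Z.
Proof.
move=> n_odd n3; rewrite -[n%:Z]expr1; apply: dvd_by_prime_parts => [|p p_pr pn]; first by lia.
have [d3|d3] := boolP (3 %| n)%N; first by left; apply: det_2_3_dvd3.
have p_odd := dvdn_odd pn n_odd.
have p3 : p != 3%N by apply: contraNneq d3 => <-.
have p5 : (5 <= p)%N by have := prime_gt1 p_pr; move: p_odd p3; case: (p) => [|[|[|[|[|]]]]].
have pa := dvd_quad_coef_2_3 p_pr p_odd p3.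
have pa' : (p %| quad_coef p 2 3 (p.-1 - 2))%Z.
  apply: dvd_quad_coef_sym => //; first by lia.
  by apply: (@ndvd_prime p 3).
case: (prime_divisor_split 2 3 p_pr n_odd pn) => [|[m [En cop Hm]]]; first by left.
case: Hm => [m1|m2]; last first.
  right; exists m; split=> //; rewrite expr1 En.
  by apply: (@dvd_det_composite p 2 3 p_pr p_odd 2) => //; lia.
have np : n = p by rewrite En m1 muln1.
have [p5'|p5'] := eqVneq p 5%N; first by left; rewrite np p5' det_2_3_5.
right; exists 1%N; split; [by rewrite muln1 | by rewrite coprimen1 |].
by rewrite expr1 np; apply: (dvd_det_prime p_pr p_odd _ _ pa pa'); lia.
Qed.

(** For composite [n] the second kernel vector comes from another residue class modulo the cofactor;
    for prime [n] it comes from [j^(p-1)], available when 3 is not a square, that is for [n = 5, 7]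
    modulo 12. *)
Lemma dvd_sq_det_2_3 n : odd n -> (3 < n)%N -> (n %% 12 \in [:: 5; 7])%N \/ ~~ prime n ->
  (n%:Z ^+ 2 %| jacobi_det 2 3 n)%Z.
Proof.
move=> n_odd n3 Hn; apply: dvd_by_prime_parts => [|p p_pr pn]; first by lia.
have [d3|d3] := boolP (3 %| n)%N; first by left; apply: det_2_3_dvd3.
have p_odd := dvdn_odd pn n_odd.
have p3 : p != 3%N by apply: contraNneq d3 => <-.
have p5 : (5 <= p)%N by have := prime_gt1 p_pr; move: p_odd p3; case: (p) => [|[|[|[|[|]]]]].
have pa := dvd_quad_coef_2_3 p_pr p_odd p3.
have pa' : (p %| quad_coef p 2 3 (p.-1 - 2))%Z.
  apply: dvd_quad_coef_sym => //; first by lia.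
  by apply: (@ndvd_prime p 3).
case: (prime_divisor_split 2 3 p_pr n_odd pn) => [|[m [En cop Hm]]]; first by left.
case: Hm => [m1|m2]; last first.
  right; exists m; split=> //; rewrite En.
  have m4 : (4 < m)%N.
    move: n_odd d3; rewrite En oddM => /andP[_]; case: (m) m2 => [|[|[|[|[|]]]]] //.
    by rewrite dvdn_mull.
  by apply: (@dvd_sq_det_composite p 2 3 p_pr p_odd 2) => //; lia.
have np : n = p by rewrite En m1 muln1.
have [p5'|p5'] := eqVneq p 5%N; first by left; rewrite np p5' det_2_3_5.
right; exists 1%N; split; [by rewrite muln1 | by rewrite coprimen1 |].
case: Hn => [Hn|]; last by rewrite np p_pr.
rewrite np in Hn *; apply: (dvd_sq_det_prime p_pr p_odd _ _ _ pa pa') => //; first by lia.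
exact: dvd_symbol_3.
Qed.

Lemma dvd_det_6_15 n : odd n -> (7 < n)%N -> (n%:Z %| jacobi_det 6 15 n)%Z.
Proof.
move=> n_odd n7; rewrite -[n%:Z]expr1; apply: dvd_by_prime_parts => [|p p_pr pn]; first by lia.
have [d3|d3] := boolP (3 %| n)%N.
  by left; apply: (@det0_dvd_row _ _ _ 3) => //; lia.
have [d5|d5] := boolP (5 %| n)%N.
  by left; apply: (@det0_dvd_row _ _ _ 5) => //; lia.
have p_odd := dvdn_odd pn n_odd.
have p3 : p != 3%N by apply: contraNneq d3 => <-.
have p5 : p != 5%N by apply: contraNneq d5 => <-.
have p7 : (6 < p)%N.
  by have := prime_gt1 p_pr; move: p_odd p3 p5; case: (p) => [|[|[|[|[|[|[|]]]]]]].
have pa := dvd_quad_coef_6_15 p_pr p_odd p7.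
have pa' : (p %| quad_coef p 6 15 (p.-1 - 3))%Z.
  apply: dvd_quad_coef_sym => //; first by lia.
  rewrite dvdzE /= (@Euclid_dvdM 3 5 p) // !dvdn_prime2 //.
  by rewrite (negPf p3).
case: (prime_divisor_split 6 15 p_pr n_odd pn) => [|[m [En cop Hm]]]; first by left.
case: Hm => [m1|m2]; right.
  have np : n = p by rewrite En m1 muln1.
  exists 1%N; split; [by rewrite muln1 | by rewrite coprimen1 |].
  by rewrite expr1 np; apply: (dvd_det_prime p_pr p_odd _ _ pa pa'); lia.
exists m; split=> //; rewrite expr1 En.
by apply: (@dvd_det_composite p 6 15 p_pr p_odd 3) => //; lia.
Qed.

(** * Exponents near a quarter of [p] *)

Lemma det0_quartic c d p m : prime p -> (p %% 4 = 1)%N -> ~~ (p %| d)%Z ->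
  (forall i, (4 * i = 3 * p.-1)%N -> (p %| quad_coef p c d i)%Z) ->
  coprime p m -> m = 1%N \/ (2 < m)%N -> jacobi_det c d (p * m) = 0.
Proof.
move=> p_pr p4 pd H cop Hm; have p_odd : odd p by lia.
pose i := (p.-1 %/ 4)%N.
have E4 : (4 * i = p.-1)%N by rewrite /i; lia.
have pa' : (p %| quad_coef p c d (p.-1 - i))%Z by apply: H; lia.
have pa : (p %| quad_coef p c d i)%Z.
  rewrite (_ : i = p.-1 - (p.-1 - i))%N; last by lia.
  by apply: dvd_quad_coef_sym => //; lia.
exact: (det0_root p_pr p_odd (or_intror erefl) E4 pa pa' cop Hm).
Qed.

(** The partner of [(p - 3) / 4] is [(3p - 1) / 4], the index congruent to [-1/4]. For such [p]
    there is no primitive fourth root of unity modulo [p], and the pair serves as power functions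
    modulo [p]. *)
Lemma dvd_quad_coef_quarter3 c d p : prime p -> (p %% 4 = 3)%N -> ~~ (p %| d)%Z ->
  (forall i, (4 * i = (3 * p).-1)%N -> (p %| quad_coef p c d i)%Z) ->
  (p %| quad_coef p c d ((p - 3) %/ 4))%Z /\ (p %| quad_coef p c d (p.-1 - (p - 3) %/ 4))%Z.
Proof.
move=> p_pr p4 pd H; have p_odd : odd p by lia.
have pa' : (p %| quad_coef p c d (p.-1 - (p - 3) %/ 4))%Z by apply: H; lia.
split=> //; rewrite (_ : (p - 3) %/ 4 = p.-1 - (p.-1 - (p - 3) %/ 4))%N; last by lia.
by apply: dvd_quad_coef_sym => //; lia.
Qed.

(* A prime [p = 3 (mod 4)] dividing a sum of two squares divides it twice, and
   then two rows of the matrix coincide. *)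
Lemma det_quartic_two_squares c d n (b : pred nat) : odd n -> sum_of_two_squares n ->
  b 1%N -> (forall x y, b x -> b y -> b (x * y)%N) -> ~~ b n ->
  (forall p, prime p -> (p %| n)%N -> (p %% 4 = 1)%N -> ~~ b p ->
     ~~ (p %| d)%Z /\ forall i, (4 * i = 3 * p.-1)%N -> (p %| quad_coef p c d i)%Z) ->
  jacobi_det c d n = 0.
Proof.
move=> n_odd nS b1 bM nb H; have n0 : (0 < n)%N by lia.
have [p [p_pr pn bp]] := exists_prime_divisor b1 bM n0 nb.
have p_odd := dvdn_odd pn n_odd.
have [p4|p4] := eqVneq (p %% 4)%N 1%N; last first.
  apply: (jacobi_det_square_factor _ _ p_pr) => //.
  by apply: sum_of_two_squares_prime3 => //; lia.
have [pd pa] := H p p_pr pn p4 bp.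
case: (prime_divisor_split c d p_pr n_odd pn) => // -[m [En cop Hm]].
by rewrite En; apply: det0_quartic.
Qed.

Lemma det_5_5 n : odd n -> (n %% 20 = 13 \/ n %% 20 = 17)%N -> sum_of_two_squares n ->
  jacobi_det 5 5 n = 0.
Proof.
move=> n_odd Hn nS.
apply: (det_quartic_two_squares (b := fun k => k %% 5 \in [:: 1; 4])%N) => //.
- by move=> x y; rewrite !inE => /orP[] /eqP ex /orP[] /eqP ey; rewrite -modnMm ex ey.
- by rewrite !inE; lia.
move=> p p_pr pn p4; rewrite !inE => bp.
have p5 : p != 5%N by apply: contraTneq pn => ->; lia.
have p50 : (p %% 5 != 0)%N by rewrite -/(dvdn 5 p) dvdn_prime2 // eq_sym.
split; first by apply: (@ndvd_prime p 5).
move=> i Ei; apply: dvd_quad_coef_5_5 => //; [by lia | by left | by rewrite !inE; lia].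
Qed.

Lemma jacobi_det_5_5 n : odd n -> (n %% 20 = 11 \/ n %% 20 = 19)%N ->
  jacobi (jacobi_det 5 5 n) n = 0.
Proof.
move=> n_odd Hn; have n0 : (0 < n)%N by lia.
(* These are the classes modulo 20 of the primes for which -5 is a nonzero square. *)
have [|||p [p_pr pn bp]] := @exists_prime_divisor (fun k => k %% 20 \in [:: 1; 3; 7;
  9])%N n _ _ n0.
- by [].
- move=> x y; rewrite !inE => /or4P[] /eqP ex /or4P[] /eqP ey; by rewrite -modnMm ex ey.
- by rewrite !inE; lia.
have p_odd := dvdn_odd pn n_odd.
have p5 : p != 5%N by apply: contraTneq pn => ->; lia.
have p50 : (p %% 5 != 0)%N by rewrite -/(dvdn 5 p) dvdn_prime2 // eq_sym.
have p20 : (p %% 20 \in [:: 11; 13; 17; 19])%N by move: bp; rewrite !inE; lia.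
have pd : ~~ (p %| 5)%Z by apply: (@ndvd_prime p 5).
apply: (jacobi_dvd_eq0 p_pr) => //.
case: (prime_divisor_split 5 5 p_pr n_odd pn) => [->|[m [En cop Hm]]]; first by rewrite dvdz0.
have [p4|p4] := eqVneq (p %% 4)%N 1%N.
  rewrite En det0_quartic ?dvdz0 // => i Ei.
  by apply: dvd_quad_coef_5_5 => //; left.
have {}p4 : (p %% 4 = 3)%N by lia.
have [|pa pa'] := @dvd_quad_coef_quarter3 5 5 p p_pr p4 pd.
  by move=> i Ei; apply: dvd_quad_coef_5_5 => //; right.
have p11 : (11 <= p)%N.
  by apply: leq_trans (leq_mod p 20); move: p20; rewrite !inE => /or4P[] /eqP ->.
case: Hm => [m1|m2]; last first.
  rewrite En; apply: (@dvd_det_composite p 5 5 p_pr p_odd ((p - 3) %/ 4)) => //.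
  by lia.
by rewrite En m1 muln1; apply: (dvd_det_prime p_pr p_odd _ _ pa pa'); lia.
Qed.

Lemma det_10_9 n : odd n -> (n %% 12 = 5)%N -> sum_of_two_squares n -> jacobi_det 10 9 n = 0.
Proof.
move=> n_odd Hn nS.
apply: (det_quartic_two_squares (b := fun k => k %% 3 == 1)%N) => //.
- by move=> x y /eqP ex /eqP ey; rewrite -modnMm ex ey.
- by lia.
move=> p p_pr pn p4 bp.
have p3 : p != 3%N by apply: contraTneq pn => ->; lia.
have p30 : (p %% 3 != 0)%N by rewrite -/(dvdn 3 p) dvdn_prime2 // eq_sym.
split; first by rewrite dvdzE /= (@Euclid_dvdX 3 2) // dvdn_prime2 // (negPf p3).
by move=> i Ei; apply: dvd_quad_coef_10_9 => //; [lia | left | lia].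
Qed.

Lemma dvd_det_10_9 p : prime p -> (p %% 12 = 11)%N -> (p %| jacobi_det 10 9 p)%Z.
Proof.
move=> p_pr Hp; have p_odd : odd p by lia.
have p3 : p != 3%N by apply/eqP => E; rewrite E in Hp.
have p4 : (p %% 4 = 3)%N by lia.
have [||pa pa'] := @dvd_quad_coef_quarter3 10 9 p p_pr p4.
- by rewrite dvdzE /= (@Euclid_dvdX 3 2) // dvdn_prime2 // (negPf p3).
- by move=> i Ei; apply: dvd_quad_coef_10_9 => //; [right | lia].
by apply: (dvd_det_prime p_pr p_odd _ _ pa pa'); lia.
Qed.

Lemma ndvd_18 p : prime p -> (p %% 24 \in [:: 13; 17; 19; 23])%N -> ~~ (p %| 18)%Z.
Proof.
move=> p_pr h; rewrite dvdzE /= (@Euclid_dvdM 2 (3 ^ 2) p) // (@Euclid_dvdX 3 2 p) //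
  !dvdn_prime2 //.
by apply: contraTN h => /orP[/eqP -> | /andP[/eqP -> _]].
Qed.

Lemma det_8_18 n : odd n -> (n %% 24 = 13 \/ n %% 24 = 17)%N -> sum_of_two_squares n ->
  jacobi_det 8 18 n = 0.
Proof.
move=> n_odd Hn nS.
(* Among the primes that are 1 modulo 4, those in the classes 1 and 5 modulo 24 are the ones for
   which -6 is a square. *)
apply: (det_quartic_two_squares (b := fun k => k %% 24 \in [:: 1; 5])%N) => //.
- by move=> x y; rewrite !inE => /orP[] /eqP ex /orP[] /eqP ey; rewrite -modnMm ex ey.
- by rewrite !inE; lia.
move=> p p_pr pn p4; rewrite !inE => bp.
have p3 : p != 3%N by apply: contraTneq pn => ->; lia.
have p30 : (p %% 3 != 0)%N by rewrite -/(dvdn 3 p) dvdn_prime2 // eq_sym.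
have h : (p %% 24 \in [:: 13; 17; 19; 23])%N by rewrite !inE; lia.
split; first exact: ndvd_18.
by move=> i Ei; apply: dvd_quad_coef_8_18 => //; [lia | left].
Qed.

Lemma quad_coefs_8_18 p : prime p -> (p %% 24 = 19 \/ p %% 24 = 23)%N ->
  (p %| quad_coef p 8 18 ((p - 3) %/ 4))%Z /\ (p %| quad_coef p 8 18 (p.-1 - (p - 3) %/ 4))%Z.
Proof.
move=> p_pr Hp; have p_odd : odd p by lia.
have h : (p %% 24 \in [:: 13; 17; 19; 23])%N by rewrite !inE; lia.
apply: dvd_quad_coef_quarter3 => //; [lia | exact: ndvd_18 |].
by move=> i Ei; apply: dvd_quad_coef_8_18 => //; right.
Qed.

Lemma dvd_sq_det_8_18 p : prime p -> (p %% 24 = 19)%N -> (p%:Z ^+ 2 %| jacobi_det 8 18 p)%Z.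
Proof.
move=> p_pr Hp; have p_odd : odd p by lia.
have [pa pa'] := quad_coefs_8_18 p_pr (or_introl Hp).
apply: (dvd_sq_det_prime p_pr p_odd _ _ _ pa pa'); try by lia.
exact: dvd_symbol_18.
Qed.

Lemma dvd_det_8_18 p : prime p -> (p %% 24 = 23)%N -> (p %| jacobi_det 8 18 p)%Z.
Proof.
move=> p_pr Hp; have p_odd : odd p by lia.
have [pa pa'] := quad_coefs_8_18 p_pr (or_intror Hp).
by apply: (dvd_det_prime p_pr p_odd _ _ pa pa'); lia.
Qed.

Lemma eqz_mod0 (x : int) (l : int) : (l %| x)%Z -> (x = 0 %[mod l])%Z.
Proof. by move=> lx; apply/eqP; rewrite eqz_mod_dvd subr0. Qed.

Theorem theorem1p1 (n p : nat) (n_gt1 : (1 < n)%N) (n_odd : odd n)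
    (p_prime : prime p) :
  (* (a) *)
  ((n = 1 %[mod 4])%N -> ~ sum_of_two_squares n -> jacobi_det 3 2 n = 0)
  /\
  (* (b) *)
  (((p = 13 %[mod 24])%N \/ (p = 19 %[mod 24])%N -> jacobi_det 2 2 p = 0) /\
   ((p = 17 %[mod 24])%N \/ (p = 23 %[mod 24])%N ->
      (jacobi_det 2 2 p = 0 %[mod p%:Z])%Z))
  /\
  (* (c) *)
  (((n = 5 %[mod 8])%N -> jacobi_det 4 2 n = 0 /\ jacobi_det 8 8 n = 0) /\
   ((n = 5 %[mod 12])%N -> jacobi_det 3 3 n = 0))
  /\
  (* (d) *)
  ((n = 1 %[mod 4])%N -> jacobi n%:Z 7 = -1 ->
     jacobi_det 42 (-7) n = 0 /\ jacobi_det 21 112 n = 0)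
  /\
  (* (e) *)
  (((3 < n)%N -> (n%:Z %| jacobi_det 2 3 n)%Z) /\
   ((3 < n)%N -> ~ ((n = 1 %[mod 12])%N \/ (n = 11 %[mod 12])%N) ->
      (n%:Z ^+ 2 %| jacobi_det 2 3 n)%Z) /\
   ((3 < n)%N -> ~~ prime n -> (n%:Z ^+ 2 %| jacobi_det 2 3 n)%Z) /\
   ((7 < n)%N -> (n%:Z %| jacobi_det 6 15 n)%Z))
  /\
  (* (f) *)
  (((n = 13 %[mod 20])%N \/ (n = 17 %[mod 20])%N -> sum_of_two_squares n ->
      jacobi_det 5 5 n = 0) /\
   ((n = 11 %[mod 20])%N \/ (n = 19 %[mod 20])%N ->
      jacobi (jacobi_det 5 5 n) n = 0))
  /\
  (* (g) *)
  (((n = 5 %[mod 12])%N -> sum_of_two_squares n -> jacobi_det 10 9 n = 0) /\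
   ((p = 11 %[mod 12])%N -> (jacobi_det 10 9 p = 0 %[mod p%:Z])%Z))
  /\
  (* (h) *)
  (((n = 13 %[mod 24])%N \/ (n = 17 %[mod 24])%N -> sum_of_two_squares n ->
      jacobi_det 8 18 n = 0) /\
   ((p = 19 %[mod 24])%N -> (jacobi_det 8 18 p = 0 %[mod p%:Z ^+ 2])%Z) /\
   ((p = 23 %[mod 24])%N -> (jacobi_det 8 18 p = 0 %[mod p%:Z])%Z)).
Proof.
split; first exact: det_3_2.
split; first by split; [exact: det_2_2 | move=> h; apply/eqz_mod0/dvd_det_2_2].
split.
  split; last exact: det_3_3.
  move=> n8; split; apply: det_disc8 => //.
  - exact: dvd_quad_coef_4_2.
  - exact: dvd_symbol_2.
  - exact: dvd_quad_coef_8_8.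
  - exact: dvd_symbol_8.
split.
  move=> n4 /jacobi7_eqN1 n7; split; apply: det_disc7 => //.
  - exact: dvd_quad_coef_42_N7.
  - by move=> q q_pr q4; apply: dvd_symbol_N7 => //; lia.
  - exact: dvd_quad_coef_21_112.
  - exact: dvd_symbol_112.
split.
  split; first exact: dvd_det_2_3.
  split=> [n3 n12|]; last first.
    split; last exact: dvd_det_6_15.
    by move=> n3 n_npr; apply: dvd_sq_det_2_3 => //; right.
  have [d3|d3] := boolP (3 %| n)%N; first by rewrite det_2_3_dvd3 ?dvdz0.
  by apply: dvd_sq_det_2_3 => //; left; rewrite !inE; move: d3 n12 n_odd; lia.
split; first by split; [exact: det_5_5 | exact: jacobi_det_5_5].
split; first by split; [exact: det_10_9 | move=> h; apply/eqz_mod0/dvd_det_10_9].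
split; first exact: det_8_18.
by split=> h; apply: eqz_mod0; [apply: dvd_sq_det_8_18 | apply: dvd_det_8_18].
Qed.
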